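(* Consider the finite-horizon stochastic optimal control problem, its augmentation, the functions $f_\theta$ and the empirical risk $\hat{\mathcal R}^\pi_n$ described in the context. There is a universal constant $C>0$ such that the following holds. Let $\pi$ be a randomized Markovian policy of the augmented problem such that, for some $L_\pi>0$, $$\|\pi_t(\cdot|s,x)-\pi_t(\cdot|s',x')\|_1\le L_\pi\|(s,x)-(s',x')\|\qquad\text{for all }0\le t\le T,\ s,s'\in\mathcal S_t,\ x,x'\in\mathcal X_t.$$ For any $\epsilon>0$ and $\delta\in(0,1)$, take $$n=\left\lceil C\,\frac{T^2L_C^2}{\epsilon^2}\log\left(\frac{T^2\,\big[T^3L_CL_\pi L^{T+1}/\epsilon\big]^{d_{\mathcal S}+1}\,R^{d_{\mathcal S}}\,(L_\Theta R_\Theta/\epsilon)^{d_\Theta}}{\delta}\right)\right\rceil,$$ where inside the logarithm each of the quantities $L_C$, $L_\pi$, $L$, $R$, $L_\Theta R_\Theta/\epsilon$, $1/\epsilon$ is read as the maximum of itself and $2$. Then with probability at least $1-\delta$, $$|\hat{\mathcal R}^\pi_n(s)-\mathcal R^\pi(s)|\le\epsilon\qquad\text{for all }s\in\mathcal S_0.$$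
   Context: Stochastic optimal control (SOC) problem: $T$ is a positive integer; for $0\le t\le T$, $\mathcal S_t\subseteq\mathbb R^{d_{\mathcal S}}$ is a state space, $\mathcal A_t\subseteq\mathbb R^{d_{\mathcal A}}$ a control space, $c_t:\mathcal S_t\times\mathcal A_t\to[0,1]$ a cost; for $0\le t\le T-1$, $F_t:\mathcal S_t\times\mathcal A_t\times\Xi_t\to\mathcal S_{t+1}$ is a continuous transition function and the noise $\xi_t\in\Xi_t$ has distribution $P_t$, not depending on state or action; $\xi_0,\dots,\xi_{T-1}$ are independent. $S_{t+1}=F_t(S_t,A_t,\xi_t)$. Assumptions on the SOC: each $\mathcal S_t$ and each $\mathcal A_t$ is compact with radius $R$; there is $L>0$ with $|c_t(s,a)-c_t(s',a')|\le L\|(s,a)-(s',a')\|$ and $\|F_t(s,a,\xi)-F_t(s',a',\xi)\|\le L\|(s,a)-(s',a')\|$ for all $s,s'\in\mathcal S_t$, $a,a'\in\mathcal A_t$, $\xi\in\Xi_t$ and all $t$. Norms are Euclidean. Augmented state: $\mathcal X_t=[0,t]$, $X_0=0$, $X_{t+1}=X_t+c_t(S_t,A_t)$. A randomized Markovian policy of the augmented problem assigns to each $t$ and $(s,x)\in\mathcal S_t\times\mathcal X_t$ a probability distribution $\pi_t(\cdot|s,x)$ on $\mathcal A_t$; $A_t\sim\pi_t(\cdot|S_t,X_t)$. $\|\cdot\|_1$ between probability measures is the total mass of the absolute difference. Risk: $\mathcal R^\pi(s)=\min_{\theta\in\Theta}\mathbb E^\pi_P[f_\theta(\sum_{t=0}^Tc_t(S_t,A_t))\mid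 S_0=s]$, with $\Theta\subseteq\mathbb R^{d_\Theta}$, $f_\theta:\mathbb R\to\mathbb R$. Standing assumption: $|f_\theta(z)-f_\theta(z')|\le L_C|z-z'|$ and $|f_\theta(z)-f_{\theta'}(z)|\le L_\Theta\|\theta-\theta'\|$ for all $z,z'\in[0,T+1]$, $\theta,\theta'\in\Theta$; $\Theta$ is bounded with radius $R_\Theta$. Sampling: for every $0\le t\le T-1$ one draws $n$ i.i.d. samples from $P_t$ (independently over $t$), with empirical distribution $\hat P_{t,n}$. $\hat{\mathcal R}^\pi_n(s)$ is $\mathcal R^\pi(s)$ with $\{P_t\}$ replaced by $\{\hat P_{t,n}\}$. The policy $\pi$ is fixed (does not depend on the samples). *)

(* Defs.v *)
From HB Require Import structures.
From mathcomp Require Import all_boot all_order all_algebra.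
From mathcomp Require Import all_classical all_reals all_analysis.

Set Implicit Arguments.
Unset Strict Implicit.
Unset Printing Implicit Defensive.

Import Order.TTheory GRing.Theory Num.Theory.
Import numFieldNormedType.Exports.

Local Open Scope classical_set_scope.
Local Open Scope ring_scope.

Notation borel T := (g_sigma_algebraType (@open T)).

(* The library norm on 'rV[R]_n is the sup norm, hence this definition; both
   norms induce the same topology. *)
Definition enorm (R : realType) (n : nat) (v : 'rV[R]_n) : R :=
  Num.sqrt (\sum_(i < n) v ord0 i ^+ 2).

(* Euclidean norm of a concatenated vector (u, v), from the norms of u and v. *)
Definition pair_norm (R : realType) (a b : R) : R :=
  Num.sqrt (a ^+ 2 + b ^+ 2).

(* The centre of the ball is arbitrary, not necessarily the origin. *)
Definition has_radius (R : realType) (n : nat) (D : set 'rV[R]_n) (r : R) :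
    Prop :=
  exists v0, forall v, D v -> enorm (v - v0) <= r.

Section l1_distance.
Context d (T : measurableType d) (R : realType) (mu nu : probability T R).

Definition difference_charge : {charge set T -> \bar R} :=
  cadd (charge_of_finite_measure mu) (copp (charge_of_finite_measure nu)).

(* |mu - nu|(T), with |mu - nu| the library's variation of a charge. The value
   does not depend on the Hahn decomposition that is picked. *)
Definition l1_dist : \bar R :=
  let hP := cid (Hahn_decomposition difference_charge) in
  let hN := cid (projT2 hP) in
  charge_variation (projT2 hN) [set: T].

End l1_distance.

Definition mutually_independent (R : realType) (d : measure_display)
    (Omega : measurableType d) (Pr : probability Omega R) (I : finType)
    (dE : I -> measure_display) (E : forall i, measurableType (dE i))
    (X : forall i, Omega -> E i) : Prop :=
  forall (J : {set I}) (B : forall i, set (E i)),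
    (forall i, measurable (B i)) ->
    Pr (\bigcap_(i in [set` J]) X i @^-1` B i) =
    (\big[*%E/1%E]_(i in J) Pr (X i @^-1` B i))%E.

Record soc (R : realType) (dS dA : nat) := Soc {
  horizon : nat;
  states : nat -> set 'rV[R]_dS;
  controls : nat -> set 'rV[R]_dA;
  noise : nat -> ptopologicalType;
  cost : nat -> 'rV[R]_dS -> 'rV[R]_dA -> R;
  transition : forall t, 'rV[R]_dS -> 'rV[R]_dA -> noise t -> 'rV[R]_dS;
  noise_law : forall t, probability (borel (noise t)) R;
  horizon_gt0 : (0 < horizon)%N;
  cost_itv : forall t s a, (t <= horizon)%N -> states t s -> controls t a ->
    0 <= cost t s a <= 1;
  transition_states : forall t s a (xi : noise t), (t < horizon)%N ->
    states t s -> controls t a -> states t.+1 (transition s a xi);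
  transition_continuous : forall t, (t < horizon)%N ->
    {within (states t `*` controls t) `*` [set: noise t],
      continuous (fun z : 'rV[R]_dS * 'rV[R]_dA * noise t =>
                    transition z.1.1 z.1.2 z.2)}
}.

Arguments transition {R dS dA} M t _ _ _ : rename.

Record soc_regular (R : realType) (dS dA : nat) (M : soc R dS dA) (r L : R) :
    Prop := {
  states_compact : forall t, (t <= horizon M)%N -> compact (states M t);
  states_radius : forall t, (t <= horizon M)%N -> has_radius (states M t) r;
  controls_compact : forall t, (t <= horizon M)%N -> compact (controls M t);
  controls_radius : forall t, (t <= horizon M)%N -> has_radius (controls M t) r;
  cost_lipschitz : forall t s s' a a', (t <= horizon M)%N ->
    states M t s -> states M t s' -> controls M t a -> controls M t a' ->
    `|cost M t s a - cost M t s' a'|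
      <= L * pair_norm (enorm (s - s')) (enorm (a - a'));
  transition_lipschitz : forall t s s' a a' (xi : noise M t),
    (t < horizon M)%N ->
    states M t s -> states M t s' -> controls M t a -> controls M t a' ->
    enorm (transition M t s a xi - transition M t s' a' xi)
      <= L * pair_norm (enorm (s - s')) (enorm (a - a'))
}.

(* [policy_law pi t s x] is the distribution pi_t(. | s, x) on the control
   space; its values at (s, x) outside S_t x [0, t] are irrelevant. *)
Record policy (R : realType) (dS dA : nat) (M : soc R dS dA) := Policy {
  policy_law :> forall t : nat, 'rV[R]_dS -> R ->
    probability (borel 'rV[R]_dA) R;
  policy_controls : forall t s x, (t <= horizon M)%N -> states M t s ->
    0 <= x <= t%:R -> policy_law t s x (controls M t) = 1%E
}.

Definition policy_lipschitz (R : realType) (dS dA : nat) (M : soc R dS dA)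
    (pi : policy M) (Lpi : R) : Prop :=
  forall t s s' x x', (t <= horizon M)%N ->
    states M t s -> states M t s' -> 0 <= x <= t%:R -> 0 <= x' <= t%:R ->
    (l1_dist (pi t s x) (pi t s' x')
      <= (Lpi * pair_norm (enorm (s - s')) `|x - x'|)%:E)%E.

Section risk.
Context (R : realType) (dS dA : nat) (M : soc R dS dA) (pi : policy M).

(* Expectation of a functional G of the trajectory
   (S_t, A_t), ..., (S_{t+k}, A_{t+k}) given S_t = s and X_t = x, the law of the
   trajectory being the composition of the kernels A_u ~ pi_u(. | S_u, X_u) and
   xi_u ~ P_u, with S_{u+1} = F_u(S_u, A_u, xi_u) and
   X_{u+1} = X_u + c_u(S_u, A_u). *)
Fixpoint trajectory_expectation
    (P : forall t, {measure set (borel (noise M t)) -> \bar R})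
    (k t : nat) (s : 'rV[R]_dS) (x : R)
    (G : seq ('rV[R]_dS * 'rV[R]_dA) -> R) : R :=
  match k with
  | 0 => \int[pi t s x]_(a in controls M t) G [:: (s, a)]
  | k'.+1 =>
      \int[pi t s x]_(a in controls M t) \int[P t]_xi
        trajectory_expectation P k' t.+1
          (transition M t s a xi) (x + cost M t s a)
          (fun w => G ((s, a) :: w))
  end.

Definition total_cost (w : seq ('rV[R]_dS * 'rV[R]_dA)) : R :=
  \sum_(0 <= t < (horizon M).+1) cost M t (nth 0 w t).1 (nth 0 w t).2.

(* [inf] is the minimum over Theta whenever the latter is attained. *)
Definition risk_of (P : forall t, {measure set (borel (noise M t)) -> \bar R})
    (dTh : nat) (Theta : set 'rV[R]_dTh) (f : 'rV[R]_dTh -> R -> R)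
    (s : 'rV[R]_dS) : R :=
  inf [set trajectory_expectation P (horizon M) 0 s 0
             (fun w => f theta (total_cost w)) | theta in Theta].

Definition risk (dTh : nat) := @risk_of (fun t => noise_law M t) dTh.

Definition empirical_law (n : nat) (t : nat) (y : nat -> borel (noise M t)) :
    {measure set (borel (noise M t)) -> \bar R} :=
  mscale (n%:R^-1)%:nng (msum (fun i => \d_(y i)) n).

Definition empirical_risk (n : nat) (y : forall t, nat -> borel (noise M t))
    (dTh : nat) :=
  @risk_of (fun t => empirical_law n (y t)) dTh.

End risk.

Definition risk_family_regular (R : realType) (T dTh : nat)
    (Theta : set 'rV[R]_dTh) (f : 'rV[R]_dTh -> R -> R) (LC LTh RTh : R) :
    Prop :=
  [/\ forall theta z z', Theta theta ->
        0 <= z <= T.+1%:R -> 0 <= z' <= T.+1%:R ->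
        `|f theta z - f theta z'| <= LC * `|z - z'|,
      forall theta theta' z, Theta theta -> Theta theta' ->
        0 <= z <= T.+1%:R ->
        `|f theta z - f theta' z| <= LTh * enorm (theta - theta') &
      has_radius Theta RTh].

Definition iid_noise_samples (R : realType) (dS dA : nat) (M : soc R dS dA)
    (d : measure_display) (Omega : measurableType d) (Pr : probability Omega R)
    (n : nat) (Y : forall t, nat -> Omega -> borel (noise M t)) : Prop :=
  [/\ forall t i, (t < horizon M)%N -> (i < n)%N ->
        measurable_fun [set: Omega] (Y t i),
      forall t i B, (t < horizon M)%N -> (i < n)%N -> measurable B ->
        Pr (Y t i @^-1` B) = noise_law M t B &
      @mutually_independent R d Omega Pr ('I_(horizon M) * 'I_n)%type
        (fun p => sigma_display (@open (noise M p.1)))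
        (fun p => borel (noise M p.1)) (fun p => Y p.1 p.2)].

(* [max2] is the convention that L_C, L_pi, L, 1/eps, R and L_Theta R_Theta/eps
   are read as at least 2 inside the logarithm; the prefactor keeps L_C and eps
   as they are. *)
Definition sample_size (R : realType) (C : R) (T dS dTh : nat)
    (LC Lpi L r LTh RTh eps delta : R) : nat :=
  let max2 z := Num.max z 2 in
  `|Num.ceil (C * (T%:R ^+ 2 * LC ^+ 2 / eps ^+ 2) *
      ln (T%:R ^+ 2
          * (T%:R ^+ 3 * max2 LC * max2 Lpi * max2 L ^+ T.+1 * max2 (eps^-1))
              ^+ dS.+1
          * max2 r ^+ dS
          * max2 (LTh * RTh / eps) ^+ dTh
          / delta))|%N.

(* Main.v *)
(* The idea is Hoeffding's decomposition of multi-sample U-statistics. For fixed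
   s and theta, condition on the noise: the expected cost given a noise sequence
   (xi_0, ..., xi_{T-1}) is a bounded function h of that sequence. The true risk
   is the mean of h, the empirical risk is the average of h over all n^T ways of
   choosing one sample per stage, and that average is an average, over cyclic
   shifts, of means of n independent copies of h. By convexity of exp its
   moment generating function is dominated by that of n i.i.d. variables of range
   O(L_C T), whence the T^2 L_C^2 / eps^2 rate, with no union bound over the
   intermediate states. A union bound over nets of S_0 and Theta suffices, since
   the value functions are Lipschitz in the state: the policy is Lipschitz in
   total variation. Joint measurability of h is avoided by first splitting each
   noise space into finitely many Borel cells on which the transition functions
   are nearly constant; independence is then only used for finite codes. *)

Require Import Defs.
From HB Require Import structures.
From mathcomp Require Import all_boot all_order all_algebra.
From mathcomp Require Import all_classical all_reals all_analysis.
From mathcomp Require Import measurable_realfun ring lra zify.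
Set Implicit Arguments.
Unset Strict Implicit.
Unset Printing Implicit Defensive.
Import Order.TTheory GRing.Theory Num.Theory.
Import numFieldNormedType.Exports.
Local Open Scope classical_set_scope.
Local Open Scope ring_scope.

(** * Exponential moments of multi-sample averages *)

(** A universal [C] requires covering numbers of the form (const * K)^d. The cube around a ball of
    radius r contains about (K sqrt d)^d grid cells of diameter r / K; the logarithm of d^(d/2) is
    of order d log d, more than a constant multiple of d log K. Hence only the lattice points of an
    l1 ball are counted. The base of the power dS + 1 in the logarithm comes from the Lipschitz
    constant of the value in the initial state. The policy is controlled in total variation only, so
    each stage adds the oscillation of f_theta, about L_C T, times L_pi. Over T + 1 stages this
    gives T^2 L_C L_pi, amplified by the dynamics to T^2 L_C L_pi L^(T+1). The accumulated cost
    enters additively, so its own constant grows only linearly in the number of stages. The number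
    of noise cells never enters the tail bound, which sees only the range of h; the cells may
    therefore be as fine as desired. The function [value] takes arbitrary noise laws, so its bounds
    are proved once for the true laws, the empirical laws and the Dirac laws of a fixed noise
    sequence. *)

Lemma expR_le_quadratic (R : realType) (x D : R) :
  `|x| <= D -> D < 1 / 2 -> expR x <= 1 + x + 2 * D ^+ 2.
Proof.
rewrite ler_norml => /andP[x1 x2] Dlt.
have e0 := expR_ge1Dx (- x).
have e1 : expR x <= (1 - x)^-1.
  by rewrite -[expR x]invrK -expRN lef_pV2 ?posrE ?expR_gt0//; lra.
(* Multiplied out, the claim is [x ^+ 2 <= 2 * D ^+ 2 * (1 - x)], which holds because
   [1 - x >= 1 / 2] and [x ^+ 2 <= D ^+ 2]. *)
apply: (le_trans e1); rewrite -div1r ler_pdivrMr; last lra.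
have : 0 <= 2 * D ^+ 2 - x ^+ 2 - x ^+ 2 by nra.
by nra.
Qed.

(* For [D < 1/2] the linear terms of the quadratic bound average out; for
   larger [D] already [D <= 2 * D ^+ 2]. *)
Lemma expR_mean_bound (R : realType) (I : finType) (w X : I -> R) (D : R) :
  (forall i, 0 <= w i) -> \sum_i w i = 1 -> \sum_i w i * X i = 0 ->
  (forall i, `|X i| <= D) -> \sum_i w i * expR (X i) <= expR (2 * D ^+ 2).
Proof.
move=> w0 w1 wX XD.
have [Dlt|Dge] := ltP D (1 / 2).
  apply: le_trans (_ : \sum_i (w i + w i * X i + w i * (2 * D ^+ 2)) <= _).
    apply: ler_sum => i _; have h := expR_le_quadratic (XD i) Dlt.
    by rewrite -[X in X + _ + _]mulr1 -!mulrDr ler_wpM2l.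
  rewrite !big_split/= w1 wX -mulr_suml w1 mul1r addr0.
  exact: expR_ge1Dx.
apply: le_trans (_ : \sum_i w i * expR (2 * D ^+ 2) <= _).
  apply: ler_sum => i _; rewrite ler_wpM2l// ler_expR.
  by apply: (le_trans (ler_norm _)); apply: (le_trans (XD i)); nra.
by rewrite -mulr_suml w1 mul1r.
Qed.

(** Jensen's inequality through the tangent of [expR] at the mean [m]: the linear terms average to
    zero. *)
Lemma expR_average (R : realType) (I : finType) (c : R) (F : I -> R) :
  0 <= c -> c * #|I|%:R = 1 ->
  expR (c * \sum_i F i) <= c * \sum_i expR (F i).
Proof.
move=> c0 c1; set m := c * \sum_i F i.
have <- : c * \sum_i expR m * (1 + (F i - m)) = expR m.
  rewrite -mulr_sumr mulrCA big_split/= sumrB !sumr_const -[m *+ _]mulr_natr.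
  by rewrite mulrDr mulrBr -/m [c * (m * _)]mulrCA c1 mulr1 subrr addr0 mulr1.
apply: ler_wpM2l => //; apply: ler_sum => i _.
rewrite -[in leRHS](subrKC m (F i)) expRD.
by rewrite ler_wpM2l ?expR_ge0// expR_ge1Dx.
Qed.

Section multisample.
Context (R : realType) (T n : nat) (Q : finType) (p : 'I_T -> Q -> R).
Context (p_ge0 : forall t q, 0 <= p t q) (p_sum1 : forall t, \sum_q p t q = 1).

Definition prod_weight (rho : {ffun 'I_T -> Q}) : R := \prod_t p t (rho t).

Definition prod_mean (h : {ffun 'I_T -> Q} -> R) : R :=
  \sum_(rho : {ffun 'I_T -> Q}) prod_weight rho * h rho.

(* [z j t] is the j-th draw at stage t *)
Definition sample_weight (z : {ffun 'I_n.+1 -> {ffun 'I_T -> Q}}) : R :=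
  \prod_j prod_weight (z j).

Definition freq (z : {ffun 'I_n.+1 -> {ffun 'I_T -> Q}}) (t : 'I_T) (q : Q) : R :=
  n.+1%:R^-1 * \sum_j (z j t == q)%:R.

Definition sample_mean (z : {ffun 'I_n.+1 -> {ffun 'I_T -> Q}})
    (h : {ffun 'I_T -> Q} -> R) : R :=
  \sum_(rho : {ffun 'I_T -> Q}) (\prod_t freq z t (rho t)) * h rho.

Lemma prod_weight_ge0 rho : 0 <= prod_weight rho.
Proof. by apply: prodr_ge0. Qed.

Lemma sample_weight_ge0 z : 0 <= sample_weight z.
Proof. by apply: prodr_ge0 => j _; exact: prod_weight_ge0. Qed.

Lemma prod_weight_sum1 : \sum_(rho : {ffun 'I_T -> Q}) prod_weight rho = 1.
Proof.
rewrite /prod_weight -(bigA_distr_bigA p).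
by rewrite big1.
Qed.

Lemma prod_mean_dist h c D : (forall rho, `|h rho - c| <= D) ->
  `|prod_mean h - c| <= D.
Proof.
move=> hD; rewrite -[c]mul1r -prod_weight_sum1 mulr_suml -sumrB.
apply: le_trans (ler_norm_sum _ _ _) _.
apply: le_trans (_ : \sum_(rho : {ffun 'I_T -> Q}) prod_weight rho * D <= _).
  apply: ler_sum => rho _; rewrite -mulrBr normrM ger0_norm ?prod_weight_ge0//.
  by rewrite ler_wpM2l ?prod_weight_ge0.
by rewrite -mulr_suml prod_weight_sum1 mul1r.
Qed.

Definition select (z : {ffun 'I_n.+1 -> {ffun 'I_T -> Q}})
    (k : {ffun 'I_T -> 'I_n.+1}) : {ffun 'I_T -> Q} := [ffun t => z (k t) t].

(** Expanding the product of frequencies over index tuples [k] leaves a product of indicators, which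
    is nonzero only for [rho = select z k]. *)
Lemma sample_mean_select z h :
  sample_mean z h =
  (n.+1%:R ^+ T)^-1 * \sum_(k : {ffun 'I_T -> 'I_n.+1}) h (select z k).
Proof.
rewrite /sample_mean /freq.
under eq_bigr => rho _.
  rewrite big_split/= prodr_const card_ord.
  rewrite (bigA_distr_bigA (fun t j => (z j t == rho t)%:R)).
  rewrite exprVn -mulrA big_distrl/=.
  over.
rewrite -mulr_sumr; congr (_ * _).
rewrite exchange_big/=; apply: eq_bigr => k _.
rewrite (bigD1 (select z k))//= [X in _ + X]big1 => [|rho /eqP rk].
  by rewrite addr0 big1 ?mul1r// => t _; rewrite ffunE eqxx.
rewrite -natr_prod (_ : (\prod_i _)%N = 0)%N ?mul0r//.
apply/eqP; apply: contra_notT rk => nz; apply/ffunP => t; rewrite ffunE.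
apply/esym/eqP; move: nz; rewrite prod_nat_seq_neq0 => /allP/(_ t).
by move=> /(_ (mem_index_enum _)); case: (z (k t) t == rho t).
Qed.

(** The addition is modulo [n.+1]: for fixed [k], as [j] varies, each stage uses each of its draws
    exactly once. *)
Definition shift (k : {ffun 'I_T -> 'I_n.+1}) (j : 'I_n.+1) :
  {ffun 'I_T -> 'I_n.+1} := [ffun t => k t + j].

(* Averaging over all index tuples is averaging over shifts [k] the mean over
   the [n.+1] disjoint blocks [shift k j]. *)
Lemma sample_mean_shift z h :
  sample_mean z h = (n.+1%:R ^+ T)^-1 * \sum_(k : {ffun 'I_T -> 'I_n.+1})
    n.+1%:R^-1 * \sum_j h (select z (shift k j)).
Proof.
rewrite sample_mean_select; congr (_ * _).
rewrite -mulr_sumr exchange_big/=.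
have shiftE (j : 'I_n.+1) :
    \sum_(k : {ffun 'I_T -> 'I_n.+1}) h (select z (shift k j)) =
    \sum_(k : {ffun 'I_T -> 'I_n.+1}) h (select z k).
  rewrite [RHS](reindex (fun k => shift k j))//.
  by exists (fun k => shift k (- j)) => k _; apply/ffunP => t;
    rewrite !ffunE ?addrK ?subrK.
under [X in _ * X]eq_bigr do rewrite shiftE.
by rewrite sumr_const card_ord -[X in _ * X]mulr_natl mulrA mulVf ?mul1r ?pnatr_eq0.
Qed.

(** Rotating the draws of stage [t] by [k t] permutes the samples and preserves their weights. It
    turns the shifted blocks into the rows [z j], over which the weight factorizes. *)
Lemma sum_sample_block (k : {ffun 'I_T -> 'I_n.+1})
    (G : {ffun 'I_T -> Q} -> R) :
  \sum_z sample_weight z * \prod_j G (select z (shift k j)) =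
  (\sum_(rho : {ffun 'I_T -> Q}) prod_weight rho * G rho) ^+ n.+1.
Proof.
transitivity (\sum_z sample_weight z * \prod_j G (z j)).
  rewrite [RHS](reindex (fun z : {ffun 'I_n.+1 -> {ffun 'I_T -> Q}} =>
    [ffun j => select z (shift k j)])).
    apply: eq_bigr => z _; congr (_ * _); last first.
      by apply: eq_bigr => j _; rewrite ffunE.
    rewrite /sample_weight /prod_weight.
    rewrite exchange_big [RHS]exchange_big/=; apply: eq_bigr => t _.
    rewrite (reindex (fun j => k t + j))/=.
      by apply: eq_bigr => j _; rewrite !ffunE.
    by exists (fun j => - k t + j) => j _; rewrite ?addKr ?addNKr.
  exists (fun z : {ffun 'I_n.+1 -> {ffun 'I_T -> Q}} =>
    [ffun j => [ffun t => z (j - k t) t]]) => z _;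
    apply/ffunP => j; apply/ffunP => t; rewrite !ffunE.
    by rewrite addrC subrK.
  by rewrite addrC addKr.
under eq_bigr do rewrite -big_split/=.
rewrite -(bigA_distr_bigA (fun (j : 'I_n.+1) rho => prod_weight rho * G rho)).
by rewrite prodr_const card_ord.
Qed.

Lemma sample_mgf h D lam : (forall rho, `|h rho - prod_mean h| <= D) ->
  \sum_z sample_weight z * expR (lam * (sample_mean z h - prod_mean h))
  <= expR (2 * (lam * D) ^+ 2 / n.+1%:R).
Proof.
move=> hD; set N : R := n.+1%:R; have N0 : 0 < N by rewrite ltr0n.
pose G rho := expR (lam / N * (h rho - prod_mean h)).
pose cT := (N ^+ T)^-1.
have cT0 : 0 <= cT by rewrite invr_ge0 exprn_ge0// ltW.
have card_tuples : cT * #|{ffun 'I_T -> 'I_n.+1}|%:R = 1.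
  by rewrite card_ffun !card_ord natrX mulVf// expf_neq0// gt_eqF.
apply: le_trans (_ : \sum_z sample_weight z *
  (cT * \sum_(k : {ffun 'I_T -> 'I_n.+1}) \prod_j G (select z (shift k j))) <= _).
  apply: ler_sum => z _; rewrite ler_wpM2l ?sample_weight_ge0//.
  have -> : lam * (sample_mean z h - prod_mean h) =
    cT * \sum_(k : {ffun 'I_T -> 'I_n.+1})
      \sum_j lam / N * (h (select z (shift k j)) - prod_mean h).
    under eq_bigr do rewrite -mulr_sumr sumrB sumr_const card_ord.
    rewrite -mulr_sumr sumrB sumr_const -[_ *+ n.+1]mulr_natr -/N.
    rewrite -[_ *+ #|_|]mulr_natr sample_mean_shift -/N -/cT -mulr_sumr.
    rewrite -{1}[prod_mean h]mulr1 -{1}card_tuples.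
    by field; rewrite gt_eqF.
  apply: le_trans (expR_average _ cT0 card_tuples) _.
  rewrite ler_wpM2l//; apply: ler_sum => k _.
  by rewrite expR_sum.
under eq_bigr do rewrite mulrCA mulr_sumr.
rewrite -mulr_sumr exchange_big/=.
under eq_bigr do rewrite sum_sample_block.
rewrite sumr_const -[X in _ * X]mulr_natl mulrA card_tuples mul1r.
(* Each of the [n.+1] independent blocks contributes one factor, with deviations scaled by
   [lam / N]. *)
have -> : expR (2 * (lam * D) ^+ 2 / N) =
    expR (2 * (`|lam / N| * D) ^+ 2) ^+ n.+1.
  rewrite -expRM_natl; congr expR; rewrite -/N [in RHS]exprMn real_normK ?num_real//.
  by field; rewrite gt_eqF.
rewrite lerXn2r ?nnegrE ?expR_ge0//.
  by apply: sumr_ge0 => rho _; rewrite mulr_ge0 ?prod_weight_ge0 ?expR_ge0.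
apply: expR_mean_bound; [exact: prod_weight_ge0|exact: prod_weight_sum1| |].
  under eq_bigr do rewrite mulrCA mulrBr.
  by rewrite -mulr_sumr sumrB -mulr_suml prod_weight_sum1 mul1r subrr mulr0.
by move=> rho; rewrite normrM ler_wpM2l.
Qed.

Lemma sample_upper_tail h D eps : 0 < D -> 0 < eps ->
  (forall rho, `|h rho - prod_mean h| <= D) ->
  \sum_(z | eps <= sample_mean z h - prod_mean h) sample_weight z
  <= expR (- (n.+1%:R * eps ^+ 2 / (8 * D ^+ 2))).
Proof.
move=> D0 eps0 hD; set N : R := n.+1%:R; have N0 : 0 < N by rewrite ltr0n.
(* Minimizer of the Chernoff exponent [2 * (lam * D) ^+ 2 / N - lam * eps]. *)
pose lam := N * eps / (4 * D ^+ 2).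
have lam0 : 0 <= lam by rewrite divr_ge0 ?mulr_ge0 ?sqr_ge0// ltW.
have -> : - (N * eps ^+ 2 / (8 * D ^+ 2)) =
    2 * (lam * D) ^+ 2 / N - lam * eps.
  by rewrite /lam; field; rewrite !gt_eqF.
rewrite expRD expRN ler_pdivlMr ?expR_gt0//.
apply: le_trans (sample_mgf _ hD).
rewrite big_mkcond/= mulr_suml; apply: ler_sum => z _.
case: ifP => [ez|_].
  by rewrite ler_wpM2l ?sample_weight_ge0// ler_expR ler_wpM2l.
by rewrite mul0r mulr_ge0 ?sample_weight_ge0 ?expR_ge0.
Qed.

Lemma sample_tail h D eps : 0 < D -> 0 < eps ->
  (forall rho, `|h rho - prod_mean h| <= D) ->
  \sum_(z | eps <= `|sample_mean z h - prod_mean h|) sample_weight z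
  <= 2 * expR (- (n.+1%:R * eps ^+ 2 / (8 * D ^+ 2))).
Proof.
move=> D0 eps0 hD.
pose h' rho := - h rho.
have mN : prod_mean h' = - prod_mean h.
  by rewrite /prod_mean -sumrN; apply: eq_bigr => rho _; rewrite mulrN.
have sN z : sample_mean z h' = - sample_mean z h.
  by rewrite /sample_mean -sumrN; apply: eq_bigr => rho _; rewrite mulrN.
have h'D rho : `|h' rho - prod_mean h'| <= D.
  by rewrite mN opprK /h' addrC distrC.
rewrite mulr_natl mulr2n.
apply: le_trans (lerD (sample_upper_tail D0 eps0 hD)
                      (sample_upper_tail D0 eps0 h'D)).
rewrite big_mkcond [X in _ <= X + _]big_mkcond [X in _ <= _ + X]big_mkcond.
rewrite -big_split/=; apply: ler_sum => z _.
have wz := sample_weight_ge0 z.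
rewrite mN sN -opprD real_ler_normr ?num_real//.
by case: (eps <= _) => /=; case: (eps <= _); lra.
Qed.

End multisample.

(** * Euclidean nets *)

Section euclidean_norm.
Context (R : realType) (d : nat).
Implicit Types u v w : 'rV[R]_d.

Lemma enorm_ge0 v : 0 <= enorm v.
Proof. exact: sqrtr_ge0. Qed.

Lemma sqr_enorm v : enorm v ^+ 2 = \sum_(i < d) v ord0 i ^+ 2.
Proof. by rewrite sqr_sqrtr// sumr_ge0// => i _; exact: sqr_ge0. Qed.

Lemma enormN v : enorm (- v) = enorm v.
Proof. by congr Num.sqrt; apply: eq_bigr => i _; rewrite mxE sqrrN. Qed.

Lemma enorm0 : enorm (0 : 'rV[R]_d) = 0.
Proof.
by rewrite /enorm big1 ?sqrtr0// => i _; rewrite mxE expr0n.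
Qed.

Lemma enorm_coord v i : `|v ord0 i| <= enorm v.
Proof.
rewrite -(ler_pXn2r (ltn0Sn 1)) ?nnegrE ?enorm_ge0// sqr_enorm.
rewrite real_normK ?num_real// (bigD1 i)//= lerDl.
by apply: sumr_ge0 => j _; exact: sqr_ge0.
Qed.

Lemma enorm_dot u v :
  \sum_(i < d) u ord0 i * v ord0 i <= enorm u * enorm v.
Proof.
have [u0|u0] := eqVneq (enorm u) 0.
  rewrite u0 mul0r big1// => i _.
  have := enorm_coord u i; rewrite u0 normr_le0 => /eqP ->; exact: mul0r.
have [v0|v0] := eqVneq (enorm v) 0.
  rewrite v0 mulr0 big1// => i _.
  have := enorm_coord v i; rewrite v0 normr_le0 => /eqP ->; exact: mulr0.
have {}u0 : 0 < enorm u by rewrite lt_neqAle eq_sym u0 enorm_ge0.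
have {}v0 : 0 < enorm v by rewrite lt_neqAle eq_sym v0 enorm_ge0.
set a := enorm u in u0 *; set b := enorm v in v0 *.
(* Cauchy-Schwarz by a weighted AM-GM inequality in each coordinate; with these weights the
   right-hand sides sum to exactly [a * b]. *)
have -> : a * b = \sum_(i < d)
    (b / (2 * a) * u ord0 i ^+ 2 + a / (2 * b) * v ord0 i ^+ 2).
  rewrite big_split/= -!mulr_sumr -!sqr_enorm -/a -/b; field.
  by rewrite !gt_eqF.
apply: ler_sum => i _; rewrite -subr_ge0.
set x := u _ _; set y := v _ _.
have -> : b / (2 * a) * x ^+ 2 + a / (2 * b) * y ^+ 2 - x * y =
    (b * x - a * y) ^+ 2 / (2 * a * b) by field; rewrite !gt_eqF.
by rewrite divr_ge0 ?sqr_ge0// ltW// !mulr_gt0.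
Qed.

Lemma enormD u v : enorm (u + v) <= enorm u + enorm v.
Proof.
rewrite -(ler_pXn2r (ltn0Sn 1)) ?nnegrE ?addr_ge0 ?enorm_ge0//.
rewrite sqrrD !sqr_enorm.
have -> : \sum_(i < d) (u + v) ord0 i ^+ 2 = \sum_(i < d) u ord0 i ^+ 2 +
    2 * (\sum_(i < d) u ord0 i * v ord0 i) + \sum_(i < d) v ord0 i ^+ 2.
  rewrite mulr_sumr -!big_split/=; apply: eq_bigr => i _; rewrite mxE; ring.
by have := enorm_dot u v; lra.
Qed.

Lemma enorm_dist u v w : enorm (u - w) <= enorm (u - v) + enorm (v - w).
Proof. by apply: le_trans (enormD _ _); rewrite addrA subrK. Qed.

Lemma enorm_distC u v : enorm (u - v) = enorm (v - u).
Proof. by rewrite -enormN opprB. Qed.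

Lemma enorm_le_coord v h : 0 <= h -> (forall i, `|v ord0 i| <= h) ->
  enorm v <= Num.sqrt d%:R * h.
Proof.
move=> h0 vh.
rewrite -(ler_pXn2r (ltn0Sn 1)) ?nnegrE ?mulr_ge0 ?enorm_ge0 ?sqrtr_ge0//.
rewrite sqr_enorm exprMn sqr_sqrtr ?ler0n//.
apply: le_trans (_ : \sum_(i < d) h ^+ 2 <= _).
  apply: ler_sum => i _; rewrite -(real_normK (num_real (v ord0 i))).
  by rewrite lerXn2r ?nnegrE.
by rewrite sumr_const card_ord mulr_natl.
Qed.

(** Comparison of the l1 and l2 norms, in the form suited to the mesh [r / (K * Num.sqrt d%:R)]:
    measured in that unit, a vector of the ball has l1 norm at most [d * K]. *)
Lemma enorm_sum_coord v r : 0 <= r -> enorm v <= r ->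
  Num.sqrt d%:R * \sum_(i < d) `|v ord0 i| <= d%:R * r.
Proof.
rewrite le_eqVlt => /orP[/eqP<- v0|r0 vr].
  rewrite big1 ?mulr0// => i _.
  by apply/eqP; rewrite eq_le normr_ge0 (le_trans (enorm_coord v i)).
rewrite mulr_sumr; set q := Num.sqrt _.
have qd : q ^+ 2 = d%:R by rewrite sqr_sqrtr.
apply: le_trans (_ : \sum_(i < d) (d%:R / (2 * r) * v ord0 i ^+ 2 + r / 2) <= _).
  apply: ler_sum => i _; rewrite -qd -(real_normK (num_real (v ord0 i))).
  set x := `|_|; rewrite -subr_ge0.
  have -> : q ^+ 2 / (2 * r) * x ^+ 2 + r / 2 - q * x =
    (q * x - r) ^+ 2 / (2 * r) by field; rewrite gt_eqF.
  by rewrite divr_ge0 ?sqr_ge0// mulr_ge0// ltW.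
rewrite big_split/= -mulr_sumr -sqr_enorm sumr_const card_ord -[(r / 2) *+ d]mulr_natl.
have -> : d%:R * r = d%:R / (2 * r) * r ^+ 2 + d%:R * (r / 2).
  by field; rewrite gt_eqF.
rewrite lerD2r; apply: ler_wpM2l.
  by rewrite divr_ge0 ?ler0n// mulr_ge0// ltW.
by rewrite lerXn2r ?nnegrE ?enorm_ge0// ltW.
Qed.

End euclidean_norm.

Lemma pair_norm_le_add (R : realType) (a b : R) :
  0 <= a -> 0 <= b -> pair_norm a b <= a + b.
Proof.
move=> a0 b0; rewrite -(ler_pXn2r (ltn0Sn 1)) ?nnegrE ?addr_ge0 ?sqrtr_ge0//.
rewrite sqr_sqrtr ?addr_ge0 ?sqr_ge0// sqrrD.
by have := mulr_ge0 a0 b0; lra.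
Qed.

Lemma expR1_le4 (R : realType) : expR 1 <= 4 :> R.
Proof.
have := expR_ge1Dx (- (1 / 2) : R); rewrite expRN.
have e0 : (0 : R) < expR (1 / 2) by exact: expR_gt0.
move=> h; have h2 : expR (1 / 2 : R) <= 2.
  have : (expR (1 / 2 : R))^-1 * expR (1 / 2) = 1 by rewrite mulVf ?gt_eqF.
  by nra.
have -> : (1 : R) = 1 / 2 + 1 / 2 by lra.
rewrite expRD; nra.
Qed.

(** * Lattice points of l1 balls and covering numbers *)

Section lattice_count.
Context (R : realType).

Lemma geometric_sum_le (q : R) (m : nat) : 0 <= q < 1 ->
  \sum_(0 <= i < m) q ^+ i <= (1 - q)^-1.
Proof.
move=> /andP[q0 q1]; have q1' : 0 < 1 - q by rewrite subr_gt0.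
rewrite -div1r ler_pdivlMr// mulrC.
have := subrX1 q m; rewrite big_mkord => h.
have : 0 <= q ^+ m by exact: exprn_ge0.
by rewrite -opprB mulNr -h; lra.
Qed.

Lemma two_sided_geometric_sum_le (q : R) (c M : nat) : (c <= M)%N ->
  0 <= q < 1 -> \sum_(j < M) q ^+ `|j - c|%N <= 2 * (1 - q)^-1.
Proof.
move=> /subnKC <-; move: (M - c)%N => m q01; have [q0 q1] := andP q01.
rewrite big_split_ord/= mulr_natl mulr2n lerD//.
  apply: le_trans (_ : \sum_(0 <= i < c.+1) q ^+ i <= _); last first.
    exact: geometric_sum_le.
  rewrite (reindex_inj rev_ord_inj)/= big_mkord big_ord_recl/=.
  rewrite ler_wpDl ?expr0//; apply: ler_sum => i _.
  rewrite (_ : `|_ - _|%N = (bump 0 i))// /bump/=.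
  by have := ltn_ord i; lia.
rewrite -(big_mkord xpredT (fun i => q ^+ `|(c + i)%N - c|)).
rewrite (eq_bigr (fun i => q ^+ i)) => [|i _]; last by congr (_ ^+ _); lia.
exact: geometric_sum_le.
Qed.

(* Generating function bound: with [q = K / (K + 1)], every counted point
   weighs at least 1 in the expansion of [(q ^- K * \sum_j q ^+ `|j - c|) ^+ d]. *)
Lemma card_l1_ball (d K c M : nat) : (0 < K)%N -> (c <= M)%N ->
  #|[set z : {ffun 'I_d -> 'I_M} |
      (\sum_i `|z i - c| <= d * K)%N]%SET|%:R
  <= ((16 * K)%:R : R) ^+ d.
Proof.
move=> K0 cM; pose q : R := K%:R / K.+1%:R.
have K1 : (0 : R) < K.+1%:R by rewrite ltr0n.
have Kp : (0 : R) < K%:R by rewrite ltr0n.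
have q0 : 0 < q by rewrite divr_gt0.
have q1 : q < 1 by rewrite ltr_pdivrMr// mul1r ltr_nat.
have q01 : 0 <= q < 1 by rewrite (ltW q0).
(* The inverse power is [(1 + 1 / K) ^ K], at most e. Together with the two-sided sum, at most
   [2 * (K + 1) <= 4 * K], this gives the base [16 * K]. *)
have qK : (q ^+ K)^-1 <= 4.
  apply: le_trans (expR1_le4 R).
  have -> : (1 : R) = K%:R * K%:R^-1 by rewrite mulfV// gt_eqF.
  rewrite expRM_natl -exprVn lerXn2r ?nnegrE ?expR_ge0 ?invr_ge0 ?(ltW q0)//.
  apply: le_trans (expR_ge1Dx _).
  rewrite le_eqVlt; apply/orP; left; apply/eqP.
  by rewrite /q -natr1; field; rewrite !gt_eqF// natr1.
pose E (z : {ffun 'I_d -> 'I_M}) := (\sum_i `|z i - c|)%N.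
rewrite -sum1_card natr_sum.
apply: le_trans (_ : \sum_(z : {ffun 'I_d -> 'I_M})
  (q ^+ K)^-1 ^+ d * \prod_i q ^+ `|z i - c|%N <= _).
  rewrite big_mkcond/=; apply: ler_sum => z _.
  have pr0 : 0 <= (q ^+ K)^-1 ^+ d * \prod_i q ^+ `|z i - c|%N.
    rewrite mulr_ge0 ?exprn_ge0 ?invr_ge0 ?exprn_ge0 ?(ltW q0)//.
    by apply: prodr_ge0 => i _; rewrite exprn_ge0// ltW.
  case: ifP => // zE; move: zE; rewrite inE => zE.
  rewrite exprVn -exprM mulrC ler_pdivlMr ?exprn_gt0// mul1r.
  rewrite prodrXr [(K * d)%N]mulnC; apply: ler_wiXn2l => //; exact: ltW.
rewrite -mulr_sumr -(bigA_distr_bigA (fun (i : 'I_d) (j : 'I_M) => q ^+ `|j - c|%N)).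
rewrite prodr_const card_ord -exprMn lerXn2r ?nnegrE//.
  rewrite mulr_ge0 ?invr_ge0 ?exprn_ge0 ?(ltW q0)//.
  by apply: sumr_ge0 => j _; rewrite exprn_ge0// ltW.
have := two_sided_geometric_sum_le cM q01.
have -> : (1 - q)^-1 = K.+1%:R.
  apply: (can_inj invrK); rewrite invrK /q.
  have -> : (K%:R : R) = K.+1%:R - 1 by rewrite -natr1 addrK.
  by field; rewrite gt_eqF.
set S := \sum_j _ => S2.
have S0 : 0 <= S by apply: sumr_ge0 => j _; rewrite exprn_ge0// ltW.
have K2 : (K.+1%:R : R) <= 2 * K%:R by rewrite -natrM ler_nat; lia.
have qK0 : 0 <= (q ^+ K)^-1 by rewrite invr_ge0 exprn_ge0// ltW.
rewrite natrM; nra.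
Qed.

End lattice_count.

(** Cells of mesh [h = r / (K * sqrt d)] have diameter [r / K]. Rounding costs at most 1 per
    coordinate, so the codes lie in the l1 ball of radius [d * K.+1], and [16 * K.+1 <= 32 * K]. The
    number [N] is chosen before [D], so that one finite type can later encode the noise of all
    stages. Representatives are taken in [D] because the Lipschitz hypotheses hold only there. *)
Lemma ball_cover (R : realType) (d K : nat) (r : R) : (0 < K)%N -> 0 <= r ->
  exists N : nat, N%:R <= (32 * K)%:R ^+ d :> R /\
  forall D : set 'rV[R]_d, has_radius D r -> D !=set0 ->
  exists rep : 'I_N -> 'rV[R]_d, (forall i, D (rep i)) /\
    forall v, D v -> exists i, enorm (v - rep i) <= r / K%:R.
Proof.
move=> K0; rewrite le_eqVlt => /orP[/eqP<-|r0].
  exists 1%N; split.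
    by rewrite exprn_ege1// ler1n; lia.
  move=> D [v0 Dr] [v1 Dv1]; exists (fun=> v1); split=> // v Dv; exists ord0.
  rewrite mul0r (le_trans (enorm_dist _ v0 _))//.
  by rewrite (enorm_distC v0) -[leRHS]addr0 lerD ?Dr.
have [d00|d0] := posnP d.
  exists 1%N; split; first by rewrite d00 expr0.
  move=> D [v0 Dr] [v1 Dv1]; exists (fun=> v1); split=> // v Dv; exists ord0.
  rewrite /enorm big1 ?sqrtr0 ?divr_ge0 ?(ltW r0)// => j _.
  by have := ltn_ord j; rewrite {2}d00.
have Kp : (0 : R) < K%:R by rewrite ltr0n.
pose sd : R := Num.sqrt d%:R.
pose h := r / (K%:R * sd).
(* Offset making the lattice coordinates nonnegative: [r / h = K * sqrt d <= c]. *)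
pose c := (K * d)%N.
pose Z := [set z : {ffun 'I_d -> 'I_(c + c).+1} |
  (\sum_i `|z i - c| <= d * K.+1)%N]%SET.
exists #|Z|; split.
  apply: le_trans (card_l1_ball R d (ltn0Sn K) (_ : c <= (c + c).+1)%N) _; first lia.
  by rewrite lerXn2r ?nnegrE ?ler0n// ler_nat; lia.
move=> D [v0 Dr] [v1 Dv1].
pose u v i : R := (v - v0) ord0 i / h + c%:R.
pose code (v : 'rV[R]_d) : {ffun 'I_d -> 'I_(c + c).+1} :=
  [ffun i => inord (Num.truncn (u v i))].
have sd0 : 0 < sd by rewrite sqrtr_gt0 ltr0n.
have h0 : 0 < h by rewrite divr_gt0 ?mulr_gt0.
have vh v i : D v -> `|(v - v0) ord0 i / h| <= c%:R.
  move=> Dv; rewrite normrM normfV (gtr0_norm h0).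
  rewrite ler_pdivrMr ?h0//; apply: le_trans (enorm_coord _ _) _.
  apply: le_trans (Dr _ Dv) _; rewrite /h mulrCA ler_peMr//; first exact: ltW r0.
  rewrite ler_pdivlMr ?mulr_gt0 ?sd0// mul1r /c natrM ler_wpM2l ?(ltW Kp)//.
  have sd1 : 1 <= sd by rewrite -[leLHS]sqrtr1 ler_wsqrtr// ler1n.
  rewrite (_ : d%:R = sd ^+ 2); last by rewrite sqr_sqrtr.
  by rewrite expr2 ler_peMr// sqrtr_ge0.
have u0 v i : D v -> 0 <= u v i.
  move=> /vh-/(_ i); rewrite ler_norml /u => /andP[]. lra.
have u2 v i : D v -> u v i <= (c + c)%:R.
  by move=> /vh-/(_ i); rewrite ler_norml /u natrD => /andP[]; lra.
have codeE v i : D v -> code v i = Num.truncn (u v i) :> nat.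
  move=> Dv; rewrite ffunE; have := truncn_itv (u0 _ i Dv) => /andP[h1 _].
  have := le_trans h1 (u2 _ i Dv); rewrite ler_nat => h2.
  by rewrite inordK.
have codeZ v : D v -> code v \in Z.
  move=> Dv; rewrite inE -(ler_nat R) natr_sum.
  apply: le_trans (_ : \sum_(i < d) (`|(v - v0) ord0 i| / h + 1) <= _).
    apply: ler_sum => i _.
    rewrite codeE// natr_absz intr_norm rmorphB/=.
    have /andP[h1 h2] := truncn_itv (u0 _ i Dv).
    rewrite -[X in _ / X](gtr0_norm h0) -normfV -normrM.
    have := ler_norm ((v - v0) ord0 i / h).
    have := ler_norm (- ((v - v0) ord0 i / h)); rewrite normrN.
    move: h1 h2; rewrite /u -natr1 ler_norml -!pmulrn => *.
    by apply/andP; split; lra.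
  rewrite big_split/= sumr_const card_ord natrM -natr1 mulrDr mulr1 lerD2r.
  rewrite -mulr_suml; rewrite ler_pdivrMr ?h0//.
  have := enorm_sum_coord (ltW r0) (Dr _ Dv); rewrite -/sd => sE.
  have -> : d%:R * K%:R * h = d%:R * r / sd.
    by rewrite /h; field; rewrite !gt_eqF ?sd0.
  by rewrite ler_pdivlMr ?sd0// mulrC.
(* Codes that no point of [D] attains receive the default [v1]. *)
have /choice[rep repP] : forall i : 'I_#|Z|, exists v, D v /\
    ((exists w, D w /\ code w = enum_val i) -> code v = enum_val i).
  move=> i; have [[w [Dw wi]]|ni] := pselect (exists w, D w /\ code w = enum_val i).
    by exists w.
  by exists v1.
exists rep; split=> [i|v Dv]; first by have [] := repP i.
exists (enum_rank_in (codeZ _ Dv) (code v)).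
set i := enum_rank_in _ _; have iE : enum_val i = code v.
  by rewrite enum_rankK_in// codeZ.
have [Dw /(_ _)] := repP i; rewrite iE => /(_ (ex_intro _ v (conj Dv erefl))) wv.
apply: le_trans (enorm_le_coord (ltW h0) _) _; last first.
  by rewrite -/sd /h le_eqVlt; apply/orP; left; apply/eqP; field; rewrite !gt_eqF ?sd0.
move=> j; have /(congr1 val) := congr1 (fun z : {ffun _ -> _} => z j) wv.
rewrite /= !codeE// => tE.
have /andP[h1 h2] := truncn_itv (u0 _ j Dv).
have /andP[h3 h4] := truncn_itv (u0 _ j Dw).
have : `|u v j - u (rep i) j| <= 1.
  by move: h1 h2 h3 h4; rewrite tE -!natr1 ler_norml => *; apply/andP; split; lra.
have -> : u v j - u (rep i) j = (v - rep i) ord0 j / h.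
  by rewrite /u !mxE; field; rewrite gt_eqF ?h0.
by rewrite normrM normfV (gtr0_norm h0) ler_pdivrMr ?h0// mul1r.
Qed.

(** * Integration and Borel measurability *)

Section probability_integral.
Context d (T : measurableType d) (R : realType).
Context (mu : {measure set T -> \bar R}) (D : set T).
Hypotheses (mD : measurable D) (mu1 : mu D = 1%E).

Lemma bounded_integrable (f : T -> R) (c B : R) : measurable_fun D f ->
  (forall x, D x -> `|f x - c| <= B) -> mu.-integrable D (EFin \o f).
Proof.
move=> mf fB; apply: measurable_bounded_integrable => //.
  by rewrite mu1 ltry.
exists (`|c| + B); split; first exact: num_real.
move=> M cM x Dx /=; rewrite -(subrK c (f x)) (le_trans (ler_normD _ _))//.
by rewrite addrC (le_trans _ (ltW cM))// lerD2l fB.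
Qed.

Lemma Rintegral_dist_le (f g : T -> R) (e : R) :
  mu.-integrable D (EFin \o f) -> mu.-integrable D (EFin \o g) ->
  (forall x, D x -> `|f x - g x| <= e) ->
  `|\int[mu]_(x in D) f x - \int[mu]_(x in D) g x| <= e.
Proof.
move=> intf intg fg; rewrite -RintegralB//.
have intfg : mu.-integrable D (EFin \o (fun x => f x - g x)).
  by apply: eq_integrable (integrableB mD intf intg).
apply: le_trans (le_normr_Rintegral mD intfg) _.
have inte : mu.-integrable D (EFin \o (fun=> e)).
  by apply: (@bounded_integrable _ e 0) => // x _; rewrite subrr normr0.
apply: le_trans (le_Rintegral mD _ inte fg) _.
  exact: integrable_norm.
by rewrite Rintegral_cst// mu1 mulr1.
Qed.

Lemma Rintegral_dist_cst (f : T -> R) (c e : R) :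
  mu.-integrable D (EFin \o f) -> (forall x, D x -> `|f x - c| <= e) ->
  `|\int[mu]_(x in D) f x - c| <= e.
Proof.
move=> intf fc; rewrite -[X in `|_ - X|]mulr1.
have -> : (1 : R) = fine (mu D) by rewrite mu1.
rewrite -(Rintegral_cst _ mD); apply: Rintegral_dist_le => //.
by apply: (@bounded_integrable _ c 0) => // x _; rewrite subrr normr0.
Qed.

End probability_integral.

(** Adding [B - c] to [f] gives values in [[0, 2 * B]], and integrals of nonnegative functions are
    monotone in the measure. The shift integrates to the same constant against [mu] and [nu], so it
    cancels. *)
Lemma Rintegral_le_measure_add d (T : measurableType d) (R : realType)
    (mu nu v : {measure set T -> \bar R}) (D : set T) (f : T -> R) (c B e : R) :
  measurable D -> mu D = 1%E -> nu D = 1%E ->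
  (forall A, measurable A -> (mu A <= nu A + v A)%E) ->
  (v D <= e%:E)%E -> measurable_fun D f ->
  (forall x, D x -> `|f x - c| <= B) ->
  \int[mu]_(x in D) f x <= \int[nu]_(x in D) f x + 2 * B * e.
Proof.
move=> mD mu1 nu1 muv ve mf fB.
have B0 : 0 <= B.
  have /set0P[x Dx] : D != set0.
    apply/eqP => D0; move: mu1; rewrite D0 measure0 => /eqP.
    by rewrite eqe eq_sym oner_eq0.
  exact: le_trans (fB x Dx).
have f0 x : D x -> 0 <= f x - c + B.
  by move=> /fB; rewrite ler_norml => /andP[]; lra.
have f2B x : D x -> f x - c + B <= 2 * B.
  by move=> /fB; rewrite ler_norml => /andP[]; lra.
pose g : T -> R := (fun x => f x - c + B) \_ D.
have mg0 : measurable_fun D (fun x => f x - c + B).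
  by apply: measurable_funD => //; exact: measurable_funB.
have mg : measurable_fun [set: T] g by apply/(measurable_restrictT _ mD).
have intE (m : {measure set T -> \bar R}) : m D = 1%E ->
    (\int[m]_(x in D) (g x)%:E = (\int[m]_(x in D) f x + (B - c))%:E)%E.
  move=> m1.
  have intf : m.-integrable D (EFin \o f) by exact: (bounded_integrable _ _ _ fB).
  have intc k : m.-integrable D (EFin \o (fun=> k)).
    by apply: (@bounded_integrable _ _ _ _ _ mD m1 _ k 0) => // x _;
      rewrite subrr normr0.
  have -> : (\int[m]_(x in D) f x + (B - c))%R =
      (\int[m]_(x in D) (f x + (B - c)))%R.
    rewrite RintegralD// Rintegral_cst// m1 mulr1//.
  rewrite /Rintegral fineK.
    apply: eq_integral => x xD; rewrite /g patchE xD; congr EFin; lra.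
  apply: integrable_fin_num => //.
  by apply: eq_integrable (integrableD mD intf (intc (B - c))).
have leI : (\int[mu]_(x in D) (g x)%:E <=
    \int[nu]_(x in D) (g x)%:E + (2 * B * e)%:E)%E.
  have g0 x : (0 <= (g x)%:E)%E.
    rewrite lee_fin /g patchE; case: ifPn => // /set_mem; exact: f0.
  apply: le_trans (_ : \int[measure_add nu v]_(x in D) (g x)%:E <= _)%E.
    apply: ge0_le_measure_integral => //; last exact/measurable_EFinP.
    by move=> A mA; rewrite /= [leRHS]measure_addE muv.
  rewrite ge0_integral_measure_add//; last first.
    exact/measurable_funTS/measurable_EFinP.
  rewrite leeD2l//.
  apply: le_trans (_ : \int[v]_(x in D) (2 * B)%:E <= _)%E.
    apply: ge0_le_integral => //.
    - exact/measurable_funTS/measurable_EFinP.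
    - by move=> x Dx; rewrite lee_fin /g patchE mem_set// f2B.
  rewrite integral_cst// [leRHS]EFinM lee_wpmul2l// lee_fin mulr_ge0//.
move: leI; rewrite !intE// -EFinD lee_fin; lra.
Qed.

(** The variation of the difference dominates both [mu A - nu A] and [nu A - mu A], so the one-sided
    bound applies in both directions. *)
Lemma Rintegral_l1_dist d (T : measurableType d) (R : realType)
    (mu nu : probability T R) (D : set T) (f : T -> R) (c B e : R) :
  measurable D -> mu D = 1%E -> nu D = 1%E -> measurable_fun D f ->
  (forall x, D x -> `|f x - c| <= B) -> (l1_dist mu nu <= e%:E)%E ->
  `|\int[mu]_(x in D) f x - \int[nu]_(x in D) f x| <= 2 * B * e.
Proof.
move=> mD mu1 nu1 mf fB; rewrite /l1_dist.
set hP := cid _; set hN := cid _.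
pose v : {measure set T -> \bar R} := charge_variation (projT2 hN).
rewrite -/(v _) => ve.
have vD : (v D <= e%:E)%E.
  by apply: le_trans ve; apply: le_measure; rewrite ?inE.
have muv A : measurable A -> (`|mu A - nu A| <= v A)%E.
  move=> mA; apply: le_trans (abse_charge_variation _ mA).
  by rewrite /difference_charge/= /cadd/= /copp/= ?muleN1 ?mulN1e.
have fin (m : probability T R) A : measurable A -> m A \is a fin_num.
  by move=> mA; exact: fin_num_measure.
have le1 : \int[mu]_(x in D) f x <= \int[nu]_(x in D) f x + 2 * B * e.
  apply: (Rintegral_le_measure_add (v := v) (c := c)) => // A mA.
  by rewrite -leeBlDl ?fin//; apply: le_trans (muv A mA); rewrite lee_abs.
have le2 : \int[nu]_(x in D) f x <= \int[mu]_(x in D) f x + 2 * B * e.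
  apply: (Rintegral_le_measure_add (v := v) (c := c)) => // A mA.
  rewrite -leeBlDl ?fin//; apply: le_trans (muv A mA).
  by rewrite -abseN fin_num_oppeB ?fin// addeC lee_abs.
by rewrite ler_norml; apply/andP; split; lra.
Qed.

Section borel_measurability.
Context (R : realType).

Lemma open_enorm_ball (n : nat) (v0 : 'rV[R]_n) (e : R) :
  open [set v | enorm (v - v0) < e].
Proof.
rewrite openE => v/= ve; apply/nbhs_ballP.
(* [enorm] is at most [Num.sqrt n%:R] times the sup norm that defines the topology; the [+ 1] makes
   the comparison strict and keeps [k] positive for [n = 0]. *)
pose k : R := Num.sqrt n%:R + 1.
have k0 : 0 < k by rewrite ltr_pwDr// sqrtr_ge0.
exists ((e - enorm (v - v0)) / k) => /=; first by rewrite divr_gt0// subr_gt0.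
move=> w vw /=; apply: le_lt_trans (enorm_dist _ v _) _; rewrite -ltrBrDr.
set h := _ / _ in vw.
have h0 : 0 < h by rewrite divr_gt0// subr_gt0.
apply: le_lt_trans (enorm_le_coord (ltW h0) _) _ => [i|].
  case: vw => _ /(_ ord0 i); rewrite /ball/= distrC => /ltW.
  by rewrite !mxE.
have -> : e - enorm (v - v0) = k * h by rewrite /h mulrC divfK// gt_eqF.
by rewrite ltr_pM2r// ltrDl.
Qed.

Lemma open_borel (X : ptopologicalType) (U : set X) :
  open U -> measurable (U : set (borel X)).
Proof. by move=> oU; exact: sub_sigma_algebra. Qed.

Lemma compact_borel (n : nat) (K : set 'rV[R]_n) :
  compact K -> measurable (K : set (borel 'rV[R]_n)).
Proof.
move=> cK; rewrite -(setCK K); apply: measurableC; apply: open_borel.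
by apply: closed_openC; apply: compact_closed => //; exact: norm_hausdorff.
Qed.

(* For [y] real, [D `&` [set x | y < g x]] is the trace on [D] of the union of
   the balls around [x0 \in D] with [y < g x0] and radius [(g x0 - y) / k]. *)
Lemma lipschitz_comp_measurable (X : ptopologicalType) (n : nat)
    (D : set (borel X)) (phi : X -> 'rV[R]_n) (g : X -> R) (k : R) :
  measurable D -> continuous phi ->
  (forall x y, D x -> D y -> `|g x - g y| <= k * enorm (phi x - phi y)) ->
  measurable_fun (D : set (borel X)) g.
Proof.
move=> mD phic gk; pose k' := `|k| + 1.
have k0 : 0 < k' by rewrite ltr_wpDl.
have {}gk x y : D x -> D y -> g x <= g y + k' * enorm (phi x - phi y).
  move=> Dx Dy; rewrite -lerBlDl (le_trans (ler_norm _))//.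
  rewrite (le_trans (gk _ _ Dx Dy))// ler_wpM2r ?enorm_ge0//.
  by rewrite ler_wpDr// ler_norm.
move=> mD'; apply: (measurability _ (RGenOInfty.measurableE R)) => //.
move=> /= _ [_ [y ->] <-].
pose U := \bigcup_(x0 in [set x0 | D x0 /\ y < g x0])
  (phi @^-1` [set v | enorm (v - phi x0) < (g x0 - y) / k']).
rewrite (_ : _ `&` _ = D `&` U).
  apply: measurableI => //; apply: open_borel; apply: bigcup_open => x0 _.
  by apply: open_comp; [move=> x _; exact: phic|exact: open_enorm_ball].
apply/seteqP; split => x /= [Dx]; rewrite in_itv/= andbT.
  move=> yx; split=> //; exists x => //=.
  by rewrite subrr enorm0 divr_gt0// subr_gt0.
move=> [x0 [Dx0 yx0]]/=; rewrite enorm_distC ltr_pdivlMr// mulrC => xx0.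
split=> //.
by have := gk _ _ Dx0 Dx; lra.
Qed.

End borel_measurability.

(** * Value functions *)

Section value_function.
Context (R : realType) (dS dA : nat) (M : soc R dS dA) (pi : policy M).

(* Conditional expectation of [g] of the total cost given [S_t = s] and
   [X_t = x], where [k] transitions remain. *)
Fixpoint value (P : forall t, {measure set (borel (noise M t)) -> \bar R})
    (g : R -> R) (k t : nat) (s : 'rV[R]_dS) (x : R) : R :=
  match k with
  | 0 => \int[pi t s x]_(a in controls M t) g (x + cost M t s a)
  | k'.+1 => \int[pi t s x]_(a in controls M t) \int[P t]_xi
      value P g k' t.+1 (transition M t s a xi) (x + cost M t s a)
  end.

(** The induction needs an arbitrary prefix [pre] of visited states and actions: the functional
    retains the whole prefix, while [value] retains only its cost [x]. *)
Lemma trajectory_expectation_value P g k t s x pre :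
  size pre = t -> (t + k = horizon M)%N ->
  x = \sum_(0 <= u < t) cost M u (nth 0 pre u).1 (nth 0 pre u).2 ->
  trajectory_expectation pi P k t s x (fun w => g (total_cost M (pre ++ w))) =
  value P g k t s x.
Proof.
have sum_rcons p u a : size p = u ->
    \sum_(0 <= v < u.+1) cost M v (nth 0 (rcons p a) v).1 (nth 0 (rcons p a) v).2
    = \sum_(0 <= v < u) cost M v (nth 0 p v).1 (nth 0 p v).2 +
      cost M u a.1 a.2.
  move=> pu; rewrite big_nat_recr//= nth_rcons pu ltnn eqxx; congr (_ + _).
  by apply: eq_big_nat => v /andP[_ vu]; rewrite nth_rcons pu vu.
elim: k t s x pre => [|k IH] t s x pre pt tk xE /=.
  apply: eq_Rintegral => a _; rewrite /total_cost -tk addn0 cats1.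
  by rewrite sum_rcons// xE.
apply: eq_Rintegral => a _; apply: eq_Rintegral => xi _.
under [X in trajectory_expectation _ _ _ _ _ _ X]eq_fun do rewrite -cat_rcons.
apply: IH; first by rewrite size_rcons pt.
  by rewrite addSnnS.
by rewrite sum_rcons// xE.
Qed.

Lemma value_ext P P' g k t s x : (forall u, (t <= u)%N -> P u = P' u) ->
  value P g k t s x = value P' g k t s x.
Proof.
elim: k t s x => //= k IH t s x PP.
apply: eq_Rintegral => a _; rewrite PP//; apply: eq_Rintegral => xi _.
by apply: IH => u /ltnW; exact: PP.
Qed.

Context (r L Lpi : R) (reg : soc_regular M r L) (piL : policy_lipschitz pi Lpi).
Context (L_ge0 : 0 <= L) (Lpi_ge0 : 0 <= Lpi).

Let T := horizon M.

Lemma augmented_cost_itv t s a x : (t <= T)%N -> states M t s ->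
  controls M t a -> 0 <= x <= t%:R -> 0 <= x + cost M t s a <= t.+1%:R.
Proof.
move=> tT Ss Aa; have := cost_itv tT Ss Aa; rewrite -natr1.
by move=> /andP[? ?] /andP[? ?]; apply/andP; split; lra.
Qed.

Lemma controls_measurable t : (t <= T)%N ->
  measurable (controls M t : set (borel 'rV[R]_dA)).
Proof. by move=> tT; apply: compact_borel; exact: controls_compact reg _ tT. Qed.

(** Invariant of the backward induction. The bound is around a centre [c] because a change of action
    law costs oscillation, not size. The constants in [s] and [x] are separate since only the former
    is multiplied by [L] at each stage. *)
Definition tame (c D : R) (t : nat) (alpha beta : R)
    (W : 'rV[R]_dS -> R -> R) :=
  (forall s x, states M t s -> 0 <= x <= t%:R -> `|W s x - c| <= D) /\
  (forall s s' x x', states M t s -> states M t s' ->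
    0 <= x <= t%:R -> 0 <= x' <= t%:R ->
    `|W s x - W s' x'| <= alpha * enorm (s - s') + beta * `|x - x'|).

Definition tame_action (c D : R) (t : nat) (alpha beta : R)
    (q : 'rV[R]_dS -> R -> 'rV[R]_dA -> R) :=
  (forall s x a, states M t s -> 0 <= x <= t%:R -> controls M t a ->
    `|q s x a - c| <= D) /\
  (forall s s' x x' a a', states M t s -> states M t s' ->
    0 <= x <= t%:R -> 0 <= x' <= t%:R -> controls M t a -> controls M t a' ->
    `|q s x a - q s' x' a'| <=
      alpha * (enorm (s - s') + enorm (a - a')) + beta * `|x - x'|).

Lemma tame_action_integrable c D t alpha beta q s x :
  tame_action c D t alpha beta q -> (t <= T)%N ->
  states M t s -> 0 <= x <= t%:R ->
  measurable_fun (controls M t : set (borel 'rV[R]_dA)) (q s x) /\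
  (pi t s x).-integrable (controls M t) (EFin \o q s x).
Proof.
move=> [qD qL] tT Ss xt.
have mq : measurable_fun (controls M t : set (borel 'rV[R]_dA)) (q s x).
  apply: (@lipschitz_comp_measurable _ _ _ _ id _ alpha).
  - exact: controls_measurable.
  - by move=> a; exact: cvg_id.
  move=> a a' Aa Aa'; apply: le_trans (qL _ _ _ _ _ _ Ss Ss xt xt Aa Aa') _.
  by rewrite !subrr enorm0 normr0 mulr0 addr0 add0r.
split=> //; apply: (bounded_integrable _ _ (c := c) (B := D)) => //.
- exact: controls_measurable.
- exact: policy_controls.
- by move=> a Aa; exact: qD.
Qed.

Lemma tame_policy_average c D t alpha beta q : 0 <= D ->
  tame_action c D t alpha beta q -> (t <= T)%N ->
  tame c D t (alpha + 2 * D * Lpi) (beta + 2 * D * Lpi)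
    (fun s x => \int[pi t s x]_(a in controls M t) q s x a).
Proof.
move=> D0 tq tT; have mA := controls_measurable tT.
split=> [s x Ss xt|s s' x x' Ss Ss' xt xt'].
  have [mq iq] := tame_action_integrable tq tT Ss xt.
  apply: Rintegral_dist_cst => //; first exact: policy_controls.
  by move=> a Aa; exact: tq.1.
have [mq iq] := tame_action_integrable tq tT Ss xt.
have [mq' iq'] := tame_action_integrable tq tT Ss' xt'.
have iq2 : (pi t s x).-integrable (controls M t) (EFin \o q s' x').
  apply: (bounded_integrable _ _ (c := c) (B := D)) => //.
    exact: policy_controls.
  by move=> a Aa; exact: tq.1.
(* Intermediate term: action law at [(s, x)], integrand at [(s', x')]. The first difference is
   pointwise, the second is paid in total variation. *)
rewrite -[X in `|X|](subrKA (\int[pi t s x]_(a in controls M t) q s' x' a)).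
apply: le_trans (ler_normD _ _) _.
have h1 : `|\int[pi t s x]_(a in controls M t) q s x a -
    \int[pi t s x]_(a in controls M t) q s' x' a|
    <= alpha * enorm (s - s') + beta * `|x - x'|.
  apply: Rintegral_dist_le => //; first exact: policy_controls.
  move=> a Aa; apply: le_trans (tq.2 _ _ _ _ _ _ Ss Ss' xt xt' Aa Aa) _.
  by rewrite subrr enorm0 addr0.
have h2 := Rintegral_l1_dist mA (policy_controls pi tT Ss xt)
  (policy_controls pi tT Ss' xt') mq' (fun a Aa => tq.1 _ _ _ Ss' xt' Aa)
  (piL tT Ss Ss' xt xt').
apply: le_trans (lerD h1 h2) _.
have := pair_norm_le_add (enorm_ge0 (s - s')) (normr_ge0 (x - x')).
set p := pair_norm _ _ => hp.
have : 2 * D * (Lpi * p) <= 2 * D * (Lpi * (enorm (s - s') + `|x - x'|)).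
  by rewrite !ler_wpM2l// mulr_ge0.
by nra.
Qed.

Lemma transition_continuous_noise t s a : (t < T)%N ->
  states M t s -> controls M t a ->
  continuous (fun xi : noise M t => transition M t s a xi).
Proof.
move=> tT Ss Aa xi.
have /subspace_continuousP/(_ (s, a, xi)) := transition_continuous tT.
move=> /(_ (conj (conj Ss Aa) I)) h.
apply: cvg_trans h => /= U; rewrite !nbhs_filterE /= => hU.
rewrite /nbhs /=.
have : nbhs (s, a, xi) [set z |
    (states M t `*` controls M t `*` [set: noise M t]) z ->
    U (transition M t z.1.1 z.1.2 z.2)] by exact: hU.
move=> [[V W]] /= [hV hW] VW.
apply: filterS hW => xi' Wxi'.
by apply: (VW (s, a, xi')) => //=; split=> //; exact: nbhs_singleton hV.
Qed.

(** The cost does not involve the noise, so the integrand depends on [xi] only through the next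
    state: a Lipschitz function of a continuous map, hence Borel. *)
Lemma tame_noise_integrable c D t alpha beta W
    (P : {measure set (borel (noise M t)) -> \bar R}) s x a :
  tame c D t.+1 alpha beta W -> P setT = 1%E -> (t < T)%N ->
  states M t s -> controls M t a -> 0 <= x <= t%:R ->
  P.-integrable setT
    (EFin \o (fun xi => W (transition M t s a xi) (x + cost M t s a))).
Proof.
move=> [WD WL] P1 tT Ss Aa xt.
have xt' := augmented_cost_itv (ltnW tT) Ss Aa xt.
have St xi := transition_states xi tT Ss Aa.
apply: (bounded_integrable _ _ (c := c) (B := D)) => //.
  apply: (@lipschitz_comp_measurable _ _ _ _ _ _ alpha) => //.
    exact: (transition_continuous_noise tT Ss Aa).
  move=> xi xi' _ _; apply: le_trans (WL _ _ _ _ (St _) (St _) xt' xt') _.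
  by rewrite subrr normr0 mulr0 addr0.
by move=> xi _; exact: WD.
Qed.

Lemma tame_noise_average c D t alpha beta W
    (P : {measure set (borel (noise M t)) -> \bar R}) :
  0 <= alpha -> 0 <= beta ->
  tame c D t.+1 alpha beta W -> P setT = 1%E -> (t < T)%N ->
  tame_action c D t (L * (alpha + beta)) beta
    (fun s x a => \int[P]_xi W (transition M t s a xi) (x + cost M t s a)).
Proof.
move=> a0 b0 tW P1 tT; have tT' := ltnW tT.
split=> [s x a Ss xt Aa|s s' x x' a a' Ss Ss' xt xt' Aa Aa'].
  apply: Rintegral_dist_cst => //.
    exact: (tame_noise_integrable tW P1 tT Ss Aa xt).
  move=> xi _; apply: tW.1; first exact: transition_states.
  exact: augmented_cost_itv.
apply: Rintegral_dist_le => //.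
- exact: (tame_noise_integrable tW P1 tT Ss Aa xt).
- exact: (tame_noise_integrable tW P1 tT Ss' Aa' xt').
move=> xi _.
have := tW.2 _ _ _ _ (transition_states xi tT Ss Aa)
  (transition_states xi tT Ss' Aa')
  (augmented_cost_itv tT' Ss Aa xt) (augmented_cost_itv tT' Ss' Aa' xt').
move=> /le_trans; apply.
have hF := transition_lipschitz reg xi tT Ss Ss' Aa Aa'.
have hc := cost_lipschitz reg tT' Ss Ss' Aa Aa'.
have hp := pair_norm_le_add (enorm_ge0 (s - s')) (enorm_ge0 (a - a')).
set p := pair_norm _ _ in hF hc hp.
have hx : `|x + cost M t s a - (x' + cost M t s' a')| <= `|x - x'| + L * p.
  have -> : x + cost M t s a - (x' + cost M t s' a') =
    (x - x') + (cost M t s a - cost M t s' a') by ring.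
  by apply: le_trans (ler_normD _ _) _; rewrite lerD2l.
apply: le_trans (lerD (ler_wpM2l a0 hF) (ler_wpM2l b0 hx)) _.
have : (L * (alpha + beta)) * p <=
    (L * (alpha + beta)) * (enorm (s - s') + enorm (a - a')).
  by rewrite ler_wpM2l// mulr_ge0// addr_ge0.
move=> h; apply: le_trans (_ : L * (alpha + beta) * p + beta * `|x - x'| <= _).
  by rewrite le_eqVlt; apply/orP; left; apply/eqP; ring.
by rewrite lerD2r.
Qed.

Context (g : R -> R) (c D LC : R) (D_ge0 : 0 <= D) (LC_ge0 : 0 <= LC).
Context (gD : forall z, 0 <= z <= T.+1%:R -> `|g z - c| <= D).
Context (gL : forall z z', 0 <= z <= T.+1%:R -> 0 <= z' <= T.+1%:R ->
  `|g z - g z'| <= LC * `|z - z'|).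

Lemma tame_terminal_cost :
  tame_action c D T (L * LC) LC (fun s x a => g (x + cost M T s a)).
Proof.
split=> [s x a Ss xt Aa|s s' x x' a a' Ss Ss' xt xt' Aa Aa'].
  by apply: gD; exact: augmented_cost_itv.
apply: le_trans (gL (augmented_cost_itv _ Ss Aa xt)
  (augmented_cost_itv _ Ss' Aa' xt')) _ => //.
have hc := cost_lipschitz reg (leqnn _) Ss Ss' Aa Aa'.
have hp := pair_norm_le_add (enorm_ge0 (s - s')) (enorm_ge0 (a - a')).
set p := pair_norm _ _ in hc hp.
have -> : x + cost M T s a - (x' + cost M T s' a') =
  (x - x') + (cost M T s a - cost M T s' a') by ring.
apply: le_trans (ler_wpM2l LC_ge0 (ler_normD _ _)) _.
have := ler_wpM2l LC_ge0 (le_trans hc (ler_wpM2l L_ge0 hp)).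
by nra.
Qed.

Definition lipX (k : nat) : R := LC + 2 * D * Lpi *+ k.

(** With [k] transitions left, the value function has constants [lipS k.+1] and [lipX k.+1]. Index 0
    stands for [g] itself, a function of the total cost alone, whence the initial 0. *)
Fixpoint lipS (k : nat) : R :=
  if k is k'.+1 then L * (lipS k' + lipX k') + 2 * D * Lpi else 0.

Lemma lipX_ge0 k : 0 <= lipX k.
Proof. by rewrite addr_ge0// mulrn_wge0// !mulr_ge0. Qed.

Lemma lipS_ge0 k : 0 <= lipS k.
Proof.
elim: k => //= k IH; apply: addr_ge0; last by rewrite !mulr_ge0.
by rewrite mulr_ge0// addr_ge0// lipX_ge0.
Qed.

Lemma tame_value (P : forall t, {measure set (borel (noise M t)) -> \bar R}) k t :
  (forall u, (u < T)%N -> P u setT = 1%E) -> (t + k = T)%N ->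
  tame c D t (lipS k.+1) (lipX k.+1) (value P g k t).
Proof.
move=> P1; elim: k t => [|k IH] t tk.
  rewrite addn0 in tk; rewrite tk /= add0r /lipX mulr0n addr0 mulr1n.
  exact: tame_policy_average tame_terminal_cost _.
have tT : (t < T)%N by rewrite -tk addnS ltnS leq_addr.
have -> : lipX k.+2 = lipX k.+1 + 2 * D * Lpi.
  by rewrite /lipX [in LHS]mulrSr addrA.
apply: tame_policy_average => //; last exact: ltnW.
have tIH : tame c D t.+1 (lipS k.+1) (lipX k.+1) (value P g k t.+1).
  by apply: IH; rewrite addSnnS.
exact: tame_noise_average (lipS_ge0 _) (lipX_ge0 _) tIH (P1 _ tT) tT.
Qed.

End value_function.

(** * Finite noise partitions *)

Section finite_sum_integral.
Context d (T : measurableType d) (R : realType).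
Context (mu : {measure set T -> \bar R}) (D : set T).
Hypotheses (mD : measurable D) (mu1 : mu D = 1%E).

Lemma Rintegral_sum (I : Type) (s : seq I) (w : I -> R) (f : I -> T -> R) :
  (forall i, mu.-integrable D (EFin \o f i)) ->
  mu.-integrable D (EFin \o (fun x => \sum_(i <- s) w i * f i x)) /\
  \int[mu]_(x in D) (\sum_(i <- s) w i * f i x) =
  \sum_(i <- s) w i * \int[mu]_(x in D) f i x.
Proof.
move=> intf; elim: s => [|i s [IH1 IH2]].
  under eq_fun do rewrite big_nil.
  rewrite big_nil Rintegral_cst// mul0r; split=> //.
  by apply: (bounded_integrable _ _ (c := 0) (B := 0)) => // x _; rewrite subrr normr0.
have intwf : mu.-integrable D (EFin \o (fun x => w i * f i x)).
  by apply: eq_integrable (integrableZl mD (w i) (intf i)).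
split.
  apply: eq_integrable (integrableD mD intwf IH1) => //.
  by move=> x _ /=; rewrite big_cons.
under eq_Rintegral do rewrite big_cons.
by rewrite RintegralD// RintegralZl// IH2 big_cons.
Qed.

End finite_sum_integral.

Section finite_code.
Context d (T : measurableType d) (R : realType).
Context (mu : {measure set T -> \bar R}) (mu1 : mu setT = 1%E).
Context (Q : finType) (code : T -> Q).
Hypothesis mcode : forall q, measurable (code @^-1` [set q]).

Definition cell_mass (q : Q) : R := fine (mu (code @^-1` [set q])).

Lemma cell_mass_ge0 q : 0 <= cell_mass q.
Proof. by apply: fine_ge0; exact: measure_ge0. Qed.

Lemma Rintegral_code (w : Q -> R) :
  mu.-integrable setT (EFin \o (fun x => w (code x))) /\
  \int[mu]_x w (code x) = \sum_q w q * cell_mass q.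
Proof.
have wE x : w (code x) = \sum_q w q * \1_(code @^-1` [set q]) x.
  rewrite (bigD1 (code x))//= big1 ?addr0 => [|q /eqP qx].
    by rewrite indicE mem_set ?mulr1.
  by rewrite indicE memNset ?mulr0// => /esym.
have int1 q : mu.-integrable setT (EFin \o \1_(code @^-1` [set q])).
  apply: (bounded_integrable _ _ (c := 0) (B := 1)) => //.
  by move=> x _; rewrite subr0 indicE; case: (_ \in _); rewrite ?normr1 ?normr0.
under eq_fun do rewrite wE.
have [h1 ->] := Rintegral_sum measurableT mu1 (index_enum Q) w int1.
split=> //; apply: eq_bigr => q _; congr (_ * _).
by rewrite /Rintegral integral_indic// setIT.
Qed.

Lemma cell_mass_sum1 : \sum_q cell_mass q = 1.
Proof.
have [_] := Rintegral_code (fun=> 1); rewrite Rintegral_cst// mu1 mulr1.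
by under eq_bigr do rewrite mul1r.
Qed.

Lemma Rintegral_code_approx (u : T -> R) (rep : Q -> T) (e : R) :
  mu.-integrable setT (EFin \o u) ->
  (forall x, `|u x - u (rep (code x))| <= e) ->
  `|\int[mu]_x u x - \sum_q cell_mass q * u (rep q)| <= e.
Proof.
move=> intu ue; have [int_code] := Rintegral_code (u \o rep).
under eq_bigr do rewrite mulrC.
by move=> <-; apply: Rintegral_dist_le => // x _; exact: ue.
Qed.

End finite_code.

(* If [G q] ignores the coordinate [t], an independent draw [q] from its marginal
   can be identified with the coordinate itself; swapping the two preserves the
   weights. *)
Lemma prod_weight_resample (R : realType) (T : nat) (Q : finType)
    (p : 'I_T -> Q -> R) (p1 : forall t, \sum_q p t q = 1) (t : 'I_T)
    (G : Q -> {ffun 'I_T -> Q} -> R) :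
  (forall q (rho rho' : {ffun 'I_T -> Q}), (forall u, u != t -> rho u = rho' u) ->
    G q rho = G q rho') ->
  \sum_q p t q * \sum_(rho : {ffun 'I_T -> Q}) prod_weight p rho * G q rho =
  \sum_(rho : {ffun 'I_T -> Q}) prod_weight p rho * G (rho t) rho.
Proof.
move=> Gt; pose upd (rho : {ffun 'I_T -> Q}) q : {ffun 'I_T -> Q} :=
  [ffun u => if u == t then q else rho u].
under eq_bigr do rewrite mulr_sumr.
rewrite pair_big/=.
rewrite (reindex (fun x : Q * {ffun 'I_T -> Q} => (x.2 t, upd x.2 x.1)))/=.
  have pw (rho : {ffun _ -> Q}) q : p t (rho t) * prod_weight p (upd rho q) =
      p t q * prod_weight p rho.
    rewrite /prod_weight (bigD1 t)//= [in RHS](bigD1 t)//= ffunE eqxx mulrCA.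
    congr (_ * (_ * _)); apply: eq_bigr => u /negbTE ut.
    by rewrite ffunE ut.
  under eq_bigr => x _.
    rewrite mulrA pw (Gt _ _ x.2); last by move=> u /negbTE ut; rewrite ffunE ut.
    rewrite -mulrA; over.
  rewrite -(pair_big xpredT xpredT (fun q (rho : {ffun _ -> Q}) =>
    p t q * (prod_weight p rho * G (rho t) rho)))/=.
  by under eq_bigr do rewrite -mulr_sumr; rewrite -mulr_suml p1 mul1r.
exists (fun x : Q * {ffun 'I_T -> Q} => (x.2 t, upd x.2 x.1)) => -[q rho] _ /=;
  by rewrite ffunE eqxx; congr (_, _); apply/ffunP => u; rewrite !ffunE;
     case: eqP => [->|].
Qed.

Section noise_discretization.
Context (R : realType) (dS dA : nat) (M : soc R dS dA).
Context (r L : R) (reg : soc_regular M r L) (L_ge0 : 0 <= L) (r_ge0 : 0 <= r).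

Let T := horizon M.

(* The code of a noise value records, for all pairs of net points of the states
   and the controls, which net points are close to the image of the transition. *)
Lemma noise_partition (eta : R) : 0 < eta -> exists Q : finType,
  forall t, exists code : noise M t -> Q,
    (forall q, measurable (code @^-1` [set q] : set (borel (noise M t)))) /\
    ((t < T)%N -> forall xi xi', code xi = code xi' ->
      forall s a, states M t s -> controls M t a ->
      enorm (transition M t s a xi - transition M t s a xi') <= eta).
Proof.
(* For each of the two noise values, moving to net points costs [L * (2 * e)] and comparing with the
   common image point costs [2 * e]. *)
move=> eta0; pose e := eta / (4 * L + 4).
have e0 : 0 < e by rewrite divr_gt0// ltr_wpDl// mulr_ge0.
pose K := (Num.truncn (r / e)).+1.
have rK : r / K%:R <= e.
  rewrite ler_pdivrMr ?ltr0n// mulrC -ler_pdivrMr//.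
  by have /andP[_ /ltW] := truncn_itv (divr_ge0 r_ge0 (ltW e0)).
have [NS [_ netS]] := ball_cover dS (ltn0Sn (Num.truncn (r / e))) r_ge0.
have [NA [_ netA]] := ball_cover dA (ltn0Sn (Num.truncn (r / e))) r_ge0.
exists {ffun 'I_NS * 'I_NA * 'I_NS -> bool} => t.
have [[tT [[s0 Ss0] [a0 Aa0]]]|triv] := pselect ((t < T)%N /\
    (states M t !=set0 /\ controls M t !=set0)); last first.
  exists (fun=> [ffun=> false]); split=> [q|tT xi xi' _ s a Ss Aa].
    rewrite preimage_cst; case: ifP => _; [exact: measurableT|exact: measurable0].
  by exfalso; apply: triv; split=> //; split; [exists s|exists a].
have [repS [repSS closeS]] := netS _ (states_radius reg (ltnW tT)) (ex_intro _ _ Ss0).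
have [repA [repAA closeA]] := netA _ (controls_radius reg (ltnW tT)) (ex_intro _ _ Aa0).
have [repS' [_ closeS']] := netS _ (states_radius reg tT)
  (ex_intro _ _ (transition_states point tT Ss0 Aa0)).
pose F (x : 'I_NS * 'I_NA * 'I_NS) xi := transition M t (repS x.1.1) (repA x.1.2) xi.
(* The net guarantees distance at most [e]; the strict bound [2 * e] still contains such points and
   makes the set open, hence Borel. *)
pose near x : set (noise M t) := [set xi | enorm (F x xi - repS' x.2) < 2 * e].
have mnear x : measurable (near x : set (borel (noise M t))).
  apply: open_borel.
  rewrite -[near x]/(F x @^-1` [set v | enorm (v - repS' x.2) < 2 * e]).
  apply: open_comp; last exact: open_enorm_ball.
  by move=> xi _; exact: (transition_continuous_noise tT (repSS _) (repAA _)).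
exists (fun xi => [ffun x => xi \in near x]); split=> [q|_ xi xi' codeE s a Ss Aa].
  rewrite (_ : _ @^-1` _ = \bigcap_(x in [set: 'I_NS * 'I_NA * 'I_NS])
      (if q x then near x else ~` near x)).
    apply: fin_bigcap_measurable => [|x _]; first exact: finite_finset.
    by case: ifP => _ //; apply: measurableC.
  apply/seteqP; split=> [xi /= <- x _|xi /= h].
    by rewrite ffunE; case: ifPn => [/set_mem//|]; rewrite notin_setE.
  apply/ffunP => x; rewrite ffunE; have := h x I.
  by case: (q x) => ?; [rewrite mem_set|rewrite memNset].
have [i hi] := closeS _ Ss; have [j hj] := closeA _ Aa.
have [k hk] := closeS' _ (transition_states xi tT (repSS i) (repAA j)).
have near1 : near (i, j, k) xi.
  by rewrite /near/= /F/= (le_lt_trans (le_trans hk rK))// ltr_pMl// ltr1n.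
have near2 : near (i, j, k) xi'.
  have := congr1 (fun f : {ffun _ -> bool} => f (i, j, k)) codeE.
  by rewrite !ffunE (mem_set near1) => /esym/set_mem.
have hF z : enorm (transition M t s a z - F (i, j, k) z) <= L * (2 * e).
  apply: le_trans (transition_lipschitz reg z tT Ss (repSS i) Aa (repAA j)) _.
  rewrite ler_wpM2l//; apply: le_trans (pair_norm_le_add _ _) _;
    rewrite ?enorm_ge0//.
  by have := le_trans hi rK; have := le_trans hj rK; lra.
have := hF xi; have := hF xi'; rewrite enorm_distC.
move: near1 near2; rewrite /near/= [X in _ -> X < _ -> _]enorm_distC.
set y := repS' k; move=> n1 n2 h2 h1.
have d1 := enorm_dist (transition M t s a xi) (F (i, j, k) xi) y.
have d2 := enorm_dist y (F (i, j, k) xi') (transition M t s a xi').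
have d3 := enorm_dist (transition M t s a xi) y (transition M t s a xi').
have -> : eta = e * (4 * L + 4).
  by rewrite /e divfK// gt_eqF// ltr_wpDl// mulr_ge0.
by lra.
Qed.

End noise_discretization.

Section noise_paths.
Context (R : realType) (dS dA : nat) (M : soc R dS dA) (pi : policy M).
Context (r L Lpi : R) (reg : soc_regular M r L) (piL : policy_lipschitz pi Lpi).
Context (L_ge0 : 0 <= L) (Lpi_ge0 : 0 <= Lpi).
Context (g : R -> R) (c D LC : R) (D_ge0 : 0 <= D) (LC_ge0 : 0 <= LC).

Let T := horizon M.

Context (gD : forall z, 0 <= z <= T.+1%:R -> `|g z - c| <= D).
Context (gL : forall z z', 0 <= z <= T.+1%:R -> 0 <= z' <= T.+1%:R ->
  `|g z - g z'| <= LC * `|z - z'|).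
Context (Q : finType) (code : forall t, borel (noise M t) -> Q).
Arguments code : clear implicits.
Context (mcode : forall t q, measurable (code t @^-1` [set q])).
Context (eta : R).
Context (codeP : forall t, (t < T)%N -> forall xi xi' : noise M t,
  code t xi = code t xi' -> forall s a, states M t s -> controls M t a ->
  enorm (transition M t s a xi - transition M t s a xi') <= eta).

(** An empty cell gets the default [point], with weight zero since its mass is zero. *)
Definition code_rep t (q : Q) : borel (noise M t) :=
  xget point (code t @^-1` [set q]).

Lemma code_repK t xi : code t (code_rep t (code t xi)) = code t xi.
Proof.
by rewrite /code_rep; case: xgetP => [x _ //|/(_ xi)/= []].
Qed.

(* The value [point] off the horizon is irrelevant. *)
Definition noise_path (rho : {ffun 'I_T -> Q}) t : borel (noise M t) :=
  if insub t is Some u then code_rep t (rho u) else point.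

(** The expected cost given the noise, written with Dirac laws so that the estimates on [value]
    cover it. *)
Definition path_value (rho : {ffun 'I_T -> Q}) k t s x : R :=
  value pi (fun u => \d_(noise_path rho u)) g k t s x.

Lemma tame_path_value rho k t : (t + k = T)%N ->
  tame M c D t (lipS L Lpi D LC k.+1) (lipX Lpi D LC k.+1)
    (path_value rho k t).
Proof.
move=> tk; apply: (tame_value reg piL) => // u _.
exact: diracT.
Qed.

Lemma path_value_ext (rho rho' : {ffun 'I_T -> Q}) k t s x :
  (forall u : 'I_T, (t <= u)%N -> rho u = rho' u) ->
  path_value rho k t s x = path_value rho' k t s x.
Proof.
move=> rr; apply: value_ext => u tu; rewrite /noise_path.
by case: insubP => // v _ vu; rewrite rr// vu.
Qed.

Lemma path_valueS (rho : {ffun 'I_T -> Q}) k t (tT : (t < T)%N) s x :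
  (t + k.+1 = T)%N -> states M t s -> 0 <= x <= t%:R ->
  path_value rho k.+1 t s x = \int[pi t s x]_(a in controls M t)
    path_value rho k t.+1 (transition M t s a (code_rep t (rho (Ordinal tT))))
      (x + cost M t s a).
Proof.
move=> tk Ss xt; rewrite /path_value /=; apply: eq_Rintegral => a.
rewrite inE => Aa.
have tW : tame M c D t.+1 (lipS L Lpi D LC k.+1) (lipX Lpi D LC k.+1)
  (path_value rho k t.+1) by apply: tame_path_value; rewrite addSnnS.
have P1 : (\d_(noise_path rho t) : {measure set _ -> \bar R}) setT = 1%E.
  exact: diracT.
have := tame_noise_integrable tW P1 tT Ss Aa xt.
move=> /integrableP[mW _]; rewrite /Rintegral integral_dirac//.
rewrite diracT mul1e/= /noise_path insubT/=.
by rewrite /path_value.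
Qed.

Section expansion.
Context (P : forall t, {measure set (borel (noise M t)) -> \bar R}).
Context (P1 : forall u, (u < T)%N -> P u setT = 1%E).

Let p (t : 'I_T) := cell_mass (P t) (code t).

(** Policy and noise integrals alternate in [value]. Once each noise integral is a finite sum over
    cells, at a price [alpha * eta] per stage, linearity moves all the sums outside the policy
    integrals. The laws [P] are arbitrary, so the true and empirical risks become two averages of
    the same function of paths. *)
Lemma value_path_expansion alpha k t s x :
  (forall j, (j <= T)%N -> lipS L Lpi D LC j <= alpha) -> 0 <= eta ->
  (t + k = T)%N -> states M t s -> 0 <= x <= t%:R ->
  `|value pi P g k t s x -
    \sum_(rho : {ffun 'I_T -> Q}) prod_weight p rho * path_value rho k t s x|
  <= k%:R * (alpha * eta).
Proof.
move=> lipa eta0.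
have p1 u : \sum_q p u q = 1 by apply: cell_mass_sum1 => //; exact: P1.
have p0 u q : 0 <= p u q by exact: cell_mass_ge0.
elim: k t s x => [|k IH] t s x tk Ss xt.
  rewrite mul0r /path_value /= -mulr_suml prod_weight_sum1// mul1r subrr.
  by rewrite normr0.
have tT : (t < T)%N by rewrite -tk addnS ltnS leq_addr.
pose t' := Ordinal tT.
have mA : measurable (controls M t : set (borel 'rV[R]_dA)).
  exact (controls_measurable reg (ltnW tT)).
have tk' : (t.+1 + k = T)%N by rewrite addSnnS.
have a0 : 0 <= alpha by apply: le_trans (lipa 0 _).
have tV := tame_value reg piL L_ge0 Lpi_ge0 D_ge0 LC_ge0 gD gL P1 tk'.
have tVq := tame_noise_average reg L_ge0 (lipS_ge0 L_ge0 Lpi_ge0 D_ge0 LC_ge0 _)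
  (lipX_ge0 Lpi_ge0 D_ge0 LC_ge0 _) tV (P1 tT) tT.
have [_ iV] := tame_action_integrable pi reg tVq (ltnW tT) Ss xt.
pose q (rho : {ffun 'I_T -> Q}) a := path_value rho k t.+1
  (transition M t s a (code_rep t (rho t'))) (x + cost M t s a).
have iq rho : (pi t s x).-integrable (controls M t) (EFin \o q rho).
  have d1 : (\d_(code_rep t (rho t')) : {measure set _ -> \bar R}) setT = 1%E.
    exact: diracT.
  have tW := tame_path_value rho tk'.
  have tq := tame_noise_average reg L_ge0 (lipS_ge0 L_ge0 Lpi_ge0 D_ge0 LC_ge0 _)
    (lipX_ge0 Lpi_ge0 D_ge0 LC_ge0 _) tW d1 tT.
  have [_] := tame_action_integrable pi reg tq (ltnW tT) Ss xt.
  apply: (eq_integrable mA) => a /set_mem Aa.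
  have /integrableP[mW _] := tame_noise_integrable tW d1 tT Ss Aa xt.
  by rewrite /= /Rintegral integral_dirac// diracT mul1e.
have pA := policy_controls pi (ltnW tT) Ss xt.
under eq_bigr do rewrite path_valueS//.
have [isum <-] := Rintegral_sum mA pA (index_enum {ffun 'I_T -> Q})
  (fun rho => prod_weight p rho) iq.
apply: Rintegral_dist_le => // a Aa.
have xt' := augmented_cost_itv (ltnW tT) Ss Aa xt.
have St xi := transition_states xi tT Ss Aa.
have h1 : `|\int[P t]_xi value pi P g k t.+1 (transition M t s a xi) (x + cost M t s a)
   - \sum_y cell_mass (P t) (code t) y * value pi P g k t.+1
       (transition M t s a (code_rep t y)) (x + cost M t s a)| <= alpha * eta.
  apply: Rintegral_code_approx => //.
  - exact: P1.
  - exact: (tame_noise_integrable tV (P1 tT) tT Ss Aa xt).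
  move=> xi; apply: le_trans (tV.2 _ _ _ _ (St _) (St _) xt' xt') _.
  rewrite subrr normr0 mulr0 addr0.
  apply: ler_pM => //; [exact: lipS_ge0|exact: enorm_ge0|apply: lipa|].
    by rewrite -tk' addSn ltnS leq_addl.
  by apply: codeP => //; rewrite code_repK.
have h2 : `|\sum_y cell_mass (P t) (code t) y * value pi P g k t.+1
       (transition M t s a (code_rep t y)) (x + cost M t s a)
   - \sum_(rho : {ffun 'I_T -> Q}) prod_weight p rho * q rho a|
   <= k%:R * (alpha * eta).
  (* The continuation from stage [t.+1] does not read coordinate [t] of the path, so the fresh draw
     [y] can be identified with it. *)
  rewrite -(@prod_weight_resample R T Q p p1 t' (fun y rho =>
    path_value rho k t.+1 (transition M t s a (code_rep t y))
      (x + cost M t s a))); last first.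
    move=> y rho rho' rr; apply: path_value_ext => u tu; apply: rr.
    by apply/eqP => uE; move: tu; rewrite uE /= ltnn.
  rewrite -sumrB; apply: le_trans (ler_norm_sum _ _ _) _.
  apply: le_trans (_ : \sum_y p t' y * (k%:R * (alpha * eta)) <= _).
    apply: ler_sum => y _; rewrite -mulrBr normrM (ger0_norm (p0 t' y)).
    by apply: ler_wpM2l (p0 t' y) _ _ _; apply: IH.
  by rewrite -mulr_suml p1 mul1r.
rewrite -[X in `|X|](subrKA (\sum_y cell_mass (P t) (code t) y *
  value pi P g k t.+1 (transition M t s a (code_rep t y)) (x + cost M t s a))).
apply: le_trans (ler_normD _ _) _; apply: le_trans (lerD h1 h2) _.
by rewrite -[k.+1%:R]natr1 mulrDl mul1r addrC.
Qed.

End expansion.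
End noise_paths.

Section empirical.
Context (R : realType) (dS dA : nat) (M : soc R dS dA).
Context (n : nat) (y : forall t, nat -> borel (noise M t)).

Lemma empirical_law_setT t : empirical_law n.+1 (y t) setT = 1%E :> \bar R.
Proof.
rewrite /empirical_law/= /mscale/= /msum/=.
under eq_bigr do rewrite diracT.
rewrite sumEFin -EFinM sumr_const card_ord -[X in _ * X]mulr_natl mulr1.
by rewrite mulVf// pnatr_eq0.
Qed.

Lemma empirical_cell_mass t (Q : finType) (code : borel (noise M t) -> Q) q :
  cell_mass (empirical_law n.+1 (y t) : {measure set _ -> \bar R}) code q =
  n.+1%:R^-1 * \sum_(j < n.+1) (code (y t j) == q)%:R.
Proof.
rewrite /cell_mass /empirical_law /= /mscale/= /msum/=.
rewrite sumEFin -EFinM/=; congr (_ * _); apply: eq_bigr => j _.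
rewrite indicE; congr ((nat_of_bool _)%:R); apply/idP/idP => [/set_mem/= ->|/eqP <-] //.
by apply/mem_set.
Qed.

End empirical.

(** * Uniform deviation *)

Section code_law.
Context (R : realType) (d : measure_display) (Omega : measurableType d)
  (Pr : probability Omega R) (T n : nat) (dE : 'I_T -> measure_display)
  (E : forall t, measurableType (dE t)) (X : forall t, 'I_n.+1 -> Omega -> E t)
  (Q : finType) (code : forall t, E t -> Q) (p : 'I_T -> Q -> R).
Context (mX : forall t j, measurable_fun setT (X t j))
  (mcode : forall t q, measurable (@code t @^-1` [set q]))
  (lawX : forall t j q, Pr (X t j @^-1` (@code t @^-1` [set q])) = (p t q)%:E)
  (indX : mutually_independent (dE := fun ij : 'I_T * 'I_n.+1 => dE ij.1)
    (E := fun ij => E ij.1) Pr (fun ij => X ij.1 ij.2)).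

Definition sample_code (w : Omega) : {ffun 'I_n.+1 -> {ffun 'I_T -> Q}} :=
  [ffun j => [ffun t => code (X t j w)]].

Lemma sample_code_event (z : {ffun 'I_n.+1 -> {ffun 'I_T -> Q}}) :
  sample_code @^-1` [set z] = \bigcap_(ij in [set` [set: 'I_T * 'I_n.+1]%SET])
    (X ij.1 ij.2) @^-1` (@code ij.1 @^-1` [set z ij.2 ij.1]).
Proof.
apply/seteqP; split=> [w /= <- [t j] _ /=|w h]; first by rewrite !ffunE.
by apply/ffunP => j; apply/ffunP => t; rewrite !ffunE; apply: (h (t, j)) => /=; rewrite inE.
Qed.

Lemma sample_code_measurable z : measurable (sample_code @^-1` [set z]).
Proof.
rewrite sample_code_event; apply: fin_bigcap_measurable => [|[t j] _ /=].
  exact: finite_finset.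
by rewrite -[X in measurable X]setTI; apply: mX.
Qed.

Lemma sample_code_law z :
  Pr (sample_code @^-1` [set z]) = (sample_weight p z)%:E.
Proof.
rewrite sample_code_event.
have -> := indX [set: 'I_T * 'I_n.+1]%SET
  (fun ij => mcode ij.1 (z ij.2 ij.1)).
rewrite (eq_bigr (fun ij => (p ij.1 (z ij.2 ij.1))%:E)) => [|[t j] _]; last first.
  exact: lawX.
rewrite prodEFin; congr EFin.
rewrite (eq_bigl xpredT) => [|ij]; last by rewrite inE.
by rewrite -(pair_big xpredT xpredT (fun t j => p t (z j t)))/= exchange_big.
Qed.

Lemma sample_code_pred (B : pred {ffun 'I_n.+1 -> {ffun 'I_T -> Q}}) :
  measurable [set w | B (sample_code w)] /\
  (Pr [set w | B (sample_code w)] <= (\sum_(z | B z) sample_weight p z)%:E)%E.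
Proof.
have -> : [set w | B (sample_code w)] =
    \big[setU/set0]_(z | B z) (sample_code @^-1` [set z]).
  rewrite -bigcup_seq_cond; apply/seteqP.
  split=> [w Bw|w [z /= /andP[_ Bz] wz]]; last by rewrite /= wz.
  by exists (sample_code w) => //=; rewrite mem_index_enum.
have mU (s : seq {ffun 'I_n.+1 -> {ffun 'I_T -> Q}}) :
    measurable (\big[setU/set0]_(z <- s | B z) (sample_code @^-1` [set z])).
  by apply: bigsetU_measurable => z _; exact: sample_code_measurable.
split; first exact: mU.
elim: (index_enum _) => [|z s IH]; first by rewrite !big_nil measure0.
rewrite !big_cons; case: ifP => // _; rewrite EFinD.
apply: le_trans (measureU2 _ (sample_code_measurable z) (mU s)) _.
apply: leeD => //.
by have /eqP := sample_code_law z; rewrite eq_le => /andP[].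
Qed.

End code_law.

Lemma sum_exists_le (R : realType) (I J : finType) (B : J -> pred I) (w : I -> R) :
  (forall i, 0 <= w i) ->
  \sum_(i | [exists j, B j i]) w i <= \sum_j \sum_(i | B j i) w i.
Proof.
move=> w0; rewrite big_mkcond/=.
under [leRHS]eq_bigr do rewrite big_mkcond/=.
rewrite [leRHS]exchange_big/=; apply: ler_sum => i _; case: ifP => [|_].
  move=> /existsP[j Bj]; rewrite (bigD1 j)//= Bj lerDl.
  by apply: sumr_ge0 => k _; case: ifP.
by apply: sumr_ge0 => k _; case: ifP.
Qed.

(** Being bounded below passes from one family to the other, so either both infima are genuine or
    both take the default value of [inf]. *)
Lemma inf_dist_le (R : realType) (I : Type) (A : set I) (u v : I -> R) (e : R) :
  0 <= e -> (forall i, A i -> `|u i - v i| <= e) ->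
  `|inf [set u i | i in A] - inf [set v i | i in A]| <= e.
Proof.
move=> e0 uv.
have [A0|/set0P[i0 Ai0]] := eqVneq A set0.
  by rewrite A0 !image_set0 subrr normr0.
have half (f h : I -> R) : (forall i, A i -> `|f i - h i| <= e) ->
    has_lbound [set f i | i in A] -> has_lbound [set h i | i in A] /\
    inf [set f i | i in A] - e <= inf [set h i | i in A].
  move=> fh [m fm]; have lb x : A x -> inf [set f i | i in A] - e <= h x.
    move=> Ax; have := fh x Ax; rewrite ler_norml => /andP[_ h2].
    have : inf [set f i | i in A] <= f x.
      by apply: ge_inf; [exists m|exists x].
    lra.
  split; first by exists (inf [set f i | i in A] - e) => _ [x Ax <-]; exact: lb.
  by apply: lb_le_inf => [|_ [x Ax <-]]; [exists (h i0), i0|exact: lb].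
have vu i : A i -> `|v i - u i| <= e by rewrite distrC; exact: uv.
have [lu|nlu] := pselect (has_lbound [set u i | i in A]).
  have [lv h1] := half _ _ uv lu; have [_ h2] := half _ _ vu lv.
  by rewrite ler_norml; apply/andP; split; lra.
have nlv : ~ has_lbound [set v i | i in A].
  by move=> lv; apply: nlu; have [] := half _ _ vu lv.
by rewrite !inf_out ?subrr ?normr0// => -[].
Qed.

(** The bound survives the step [u -> L1 * (u + b) + b] with slack [(2 * L1 - 4) * b]; this is where
    reading [L] as at least 2 is used. *)
Lemma lipS_le (R : realType) (L Lpi D LC L1 b : R) k :
  0 <= L -> L <= L1 -> 2 <= L1 -> 0 <= D -> 0 <= LC -> 0 <= Lpi ->
  LC + 2 * D * Lpi *+ k <= b ->
  lipS L Lpi D LC k <= 3 * (L1 ^+ k - 1) * b.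
Proof.
move=> L0 LL1 L12 D0 LC0 Lpi0.
have q0 : 0 <= 2 * D * Lpi by rewrite !mulr_ge0.
elim: k => [|k IH] hb; first by rewrite expr0 subrr mulr0 mul0r.
have hb' : LC + 2 * D * Lpi *+ k <= b by rewrite (le_trans _ hb)// lerD2l ler_wpMn2l.
have := IH hb'; rewrite /= exprS => h.
have hX : lipX Lpi D LC k <= b by exact: hb'.
have hq : 2 * D * Lpi <= b.
  by move: hb; rewrite mulrSr; have := mulrn_wge0 k q0; lra.
have b0 : 0 <= b by lra.
have S0 := lipS_ge0 L0 Lpi0 D0 LC0 k.
have X0 := lipX_ge0 Lpi0 D0 LC0 k.
have : L * (lipS L Lpi D LC k + lipX Lpi D LC k) <=
    L1 * (3 * (L1 ^+ k - 1) * b + b).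
  by apply: ler_pM => //; [exact: addr_ge0|exact: lerD].
have : 0 <= (L1 - 2) * b by rewrite mulr_ge0// subr_ge0.
by nra.
Qed.

Section value_parameter.
Context (R : realType) (dS dA : nat) (M : soc R dS dA) (pi : policy M).
Context (r L Lpi : R) (reg : soc_regular M r L) (piL : policy_lipschitz pi Lpi).
Context (L_ge0 : 0 <= L) (Lpi_ge0 : 0 <= Lpi).

Let T := horizon M.

Definition lipschitz_cost (g : R -> R) (c D LC : R) :=
  (forall z, 0 <= z <= T.+1%:R -> `|g z - c| <= D) /\
  (forall z z', 0 <= z <= T.+1%:R -> 0 <= z' <= T.+1%:R ->
    `|g z - g z'| <= LC * `|z - z'|).

Lemma value_dist_cost (P : forall t, {measure set (borel (noise M t)) -> \bar R})
    (g g' : R -> R) (c c' D LC e : R) k t s x :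
  (forall u, (u < T)%N -> P u setT = 1%E) -> 0 <= D -> 0 <= LC ->
  lipschitz_cost g c D LC -> lipschitz_cost g' c' D LC ->
  (forall z, 0 <= z <= T.+1%:R -> `|g z - g' z| <= e) ->
  (t + k = T)%N -> states M t s -> 0 <= x <= t%:R ->
  `|value pi P g k t s x - value pi P g' k t s x| <= e.
Proof.
move=> P1 D0 LC0 [gD gL] [gD' gL'] gg'.
elim: k t s x => [|k IH] t s x tk Ss xt /=.
  rewrite addn0 in tk.
  have tT : (t <= T)%N by rewrite tk.
  have mA := controls_measurable reg tT.
  have pA := policy_controls pi tT Ss xt.
  rewrite {}tk in tT Ss xt mA pA *.
  apply: (Rintegral_dist_le mA pA) => [| |a Aa].
  - have tq := tame_terminal_cost reg L_ge0 LC0 gD gL.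
    by have [_] := tame_action_integrable pi reg tq tT Ss xt.
  - have tq := tame_terminal_cost reg L_ge0 LC0 gD' gL'.
    by have [_] := tame_action_integrable pi reg tq tT Ss xt.
  - by apply: gg'; exact: augmented_cost_itv.
have tT : (t < T)%N by rewrite -tk addnS ltnS leq_addr.
have tk' : (t.+1 + k = T)%N by rewrite addSnnS.
have mA := controls_measurable reg (ltnW tT).
have pA := policy_controls pi (ltnW tT) Ss xt.
have tV := tame_value reg piL L_ge0 Lpi_ge0 D0 LC0 gD gL P1 tk'.
have tV' := tame_value reg piL L_ge0 Lpi_ge0 D0 LC0 gD' gL' P1 tk'.
have l0 := lipS_ge0 L_ge0 Lpi_ge0 D0 LC0 k.+1.
have x0 := lipX_ge0 Lpi_ge0 D0 LC0 k.+1.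
apply: (Rintegral_dist_le mA pA) => [| |a Aa].
- have tq := tame_noise_average reg L_ge0 l0 x0 tV (P1 _ tT) tT.
  by have [_] := tame_action_integrable pi reg tq (ltnW tT) Ss xt.
- have tq := tame_noise_average reg L_ge0 l0 x0 tV' (P1 _ tT) tT.
  by have [_] := tame_action_integrable pi reg tq (ltnW tT) Ss xt.
apply: (Rintegral_dist_le measurableT (P1 _ tT)) => [| |xi _].
- exact: (tame_noise_integrable tV (P1 _ tT) tT Ss Aa xt).
- exact: (tame_noise_integrable tV' (P1 _ tT) tT Ss Aa xt).
- apply: IH => //; first exact: transition_states.
  by apply: augmented_cost_itv => //; exact: ltnW.
Qed.

Lemma risk_of_value (P : forall t, {measure set (borel (noise M t)) -> \bar R})
    (dTh : nat) (Theta : set 'rV[R]_dTh) (f : 'rV[R]_dTh -> R -> R) s :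
  risk_of pi P Theta f s =
  inf [set value pi P (f theta) T 0 s 0 | theta in Theta].
Proof.
rewrite /risk_of; congr inf.
suff vE theta : trajectory_expectation pi P T 0 s 0
    (fun w => f theta (total_cost M w)) = value pi P (f theta) T 0 s 0.
  by apply/seteqP; split=> _ [theta th <-]; exists theta.
apply: (@trajectory_expectation_value R dS dA M pi P (f theta) T 0 s 0 [::]) => //.
by rewrite big_nil.
Qed.

End value_parameter.

(* The tail exponent is at least [n * eps ^+ 2 / (2 ^+ 11 * T ^+ 2 * LC ^+ 2)]:
   oscillation [2 * LC * T.+1] and precision [eps / 4] in [sample_tail]. The
   remaining factor [2 ^+ 4] of [2 ^+ 15] raises the argument of the logarithm
   to the power 16, which absorbs the constants of the covering numbers. *)
Lemma sample_size_tail (R : realType) (T dS dTh : nat)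
    (LC Lpi L r LTh RTh eps delta N1 N2 : R) :
  (0 < T)%N -> 0 < LC -> 0 < eps -> 0 < delta < 1 ->
  0 <= N1 -> 0 <= N2 ->
  N1 <= (2 ^+ 13 * (T%:R ^+ 3 * Num.max LC 2 * Num.max Lpi 2 *
    Num.max L 2 ^+ T.+1 * Num.max eps^-1 2 * Num.max r 2)) ^+ dS ->
  N2 <= (2 ^+ 9 * Num.max (LTh * RTh / eps) 2) ^+ dTh ->
  let n := sample_size (2 ^+ 15) T dS dTh LC Lpi L r LTh RTh eps delta in
  (0 < n)%N /\
  2 * (N1 * N2) *
    expR (- (n%:R * (eps / 4) ^+ 2 / (8 * (2 * (LC * T.+1%:R)) ^+ 2))) <= delta.
Proof.
move=> T0 LC0 eps0 /andP[d0 d1] N10 N20 hN1 hN2.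
rewrite /sample_size.
have max2 (z : R) : 2 <= Num.max z 2 by rewrite le_max lexx orbT.
set X := T%:R ^+ 3 * _ * _ * _ * _ in hN1 *.
set r1 := Num.max r 2 in hN1 *; set k1 := Num.max (LTh * RTh / eps) 2 in hN2 *.
set Arg := T%:R ^+ 2 * _ * _ * _ / delta.
have r12 : 2 <= r1 by exact: max2.
have k12 : 2 <= k1 by exact: max2.
have T1 : (1 : R) <= T%:R by rewrite ler1n.
have X2 : 2 <= X.
  have m1 (z : R) : 1 <= Num.max z 2 by apply: le_trans (max2 z); lra.
  have h1 : 1 <= T%:R ^+ 3 * Num.max LC 2 * Num.max Lpi 2 * Num.max L 2 ^+ T.+1.
    by rewrite !mulr_ege1// exprn_ege1.
  apply: le_trans (max2 eps^-1) _; rewrite ler_peMl//.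
  by apply: le_trans (max2 _); lra.
clearbody X r1 k1.
have pow_ge1 (y : R) k : 2 <= y -> 1 <= y ^+ k.
  by move=> y2; rewrite exprn_ege1//; lra.
have ArgE : Arg = T%:R ^+ 2 * X ^+ dS.+1 * r1 ^+ dS * k1 ^+ dTh / delta by [].
have Arg2 : 2 <= Arg.
  rewrite ArgE ler_pdivlMr//; apply: le_trans (_ : 2 * 1 <= _).
    by rewrite ler_wpM2l// ltW.
  rewrite mulr1; apply: (le_trans X2).
  have -> : T%:R ^+ 2 * X ^+ dS.+1 * r1 ^+ dS * k1 ^+ dTh =
    X * (T%:R ^+ 2 * X ^+ dS * r1 ^+ dS * k1 ^+ dTh) by rewrite [X ^+ dS.+1]exprS; ring.
  apply: ler_peMr; first by lra.
  by rewrite !mulr_ege1 ?pow_ge1// exprn_ege1.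
have Arg0 : 0 < Arg by lra.
have lnArg : 0 < ln Arg by rewrite ln_gt0//; lra.
set v := 2 ^+ 15 * _ * _.
have v0 : 0 < v.
  by rewrite !mulr_gt0// ?invr_gt0 ?exprn_gt0//; lra.
set n := `|Num.ceil v|%N.
have nv : v <= n%:R.
  rewrite /n natr_absz ger0_norm; first exact: ceil_ge.
  by rewrite -(ler_int R) (le_trans _ (ceil_ge v))// ltW.
split; first by rewrite -(ltr_nat R); apply: lt_le_trans v0 nv.
have expo : 16 * ln Arg <= n%:R * (eps / 4) ^+ 2 / (8 * (2 * (LC * T.+1%:R)) ^+ 2).
  have P0 : 0 < LC * T%:R by rewrite mulr_gt0// ltr0n.
  have TS : (T.+1%:R : R) <= 2 * T%:R by rewrite -natr1; lra.
  have TS0 : (0 : R) < T.+1%:R by rewrite ltr0n.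
  have D2 : (LC * T.+1%:R) ^+ 2 <= 4 * (LC * T%:R) ^+ 2.
    have : LC * T.+1%:R <= 2 * (LC * T%:R) by rewrite mulrCA ler_wpM2l// ltW.
    have : 0 < LC * T.+1%:R by rewrite mulr_gt0.
    by nra.
  rewrite ler_pdivlMr; last by rewrite !mulr_gt0// exprn_gt0// !mulr_gt0.
  have -> : 16 * ln Arg * (8 * (2 * (LC * T.+1%:R)) ^+ 2) =
    512 * ln Arg * (LC * T.+1%:R) ^+ 2 by ring.
  apply: le_trans (_ : 512 * ln Arg * (4 * (LC * T%:R) ^+ 2) <= _).
    exact: (ler_wpM2l (mulr_ge0 (ler0n _ _) (ltW lnArg)) D2).
  apply: le_trans (_ : v * (eps / 4) ^+ 2 <= _); last first.
    by rewrite ler_wpM2r// sqr_ge0.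
  rewrite le_eqVlt; apply/orP; left; apply/eqP; rewrite /v.
  by field; rewrite gt_eqF.
apply: le_trans (_ : 2 * (N1 * N2) * expR (- (16 * ln Arg)) <= _).
  by rewrite ler_wpM2l ?mulr_ge0// ler_expR lerN2.
rewrite expRN expRM_natl lnK ?posrE// ler_pdivrMr ?exprn_gt0//.
have le16 (y z : R) : 2 <= y -> z <= 2 ^+ 13 * y -> z <= y ^+ 16.
  move=> y2 /le_trans; apply; rewrite [leRHS]exprSr.
  have y0 : 0 <= y by apply: le_trans y2.
  rewrite ler_wpM2r//; apply: le_trans (_ : 2 ^+ 15 <= _).
    by rewrite ler_weXn2l// ler1n.
  by rewrite lerXn2r ?nnegrE.
have dArg : T%:R ^+ 2 * X ^+ dS.+1 * r1 ^+ dS * k1 ^+ dTh = delta * Arg.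
  by rewrite ArgE [RHS]mulrC divfK// gt_eqF.
apply: le_trans (_ : (delta * Arg) ^+ 16 <= _); last first.
  rewrite exprMn ler_wpM2r ?exprn_ge0 ?(ltW Arg0)//.
  by rewrite exprS ler_piMr ?(ltW d0)// exprn_ile1// ltW.
rewrite -dArg 3!exprMn.
have T32 : (1 : R) <= (T%:R ^+ 2) ^+ 16 by rewrite !exprn_ege1.
have X0 : 0 <= X by apply: le_trans X2.
have r10 : 0 <= r1 by apply: le_trans r12.
have k10 : 0 <= k1 by apply: le_trans k12.
have pow13 : 0 <= 2 ^+ 13 :> R by exact: exprn_ge0.
have pow9 : 0 <= 2 ^+ 9 :> R by exact: exprn_ge0.
have Xr : 2 <= X * r1.
  by apply: (le_trans X2); rewrite ler_peMr// (le_trans _ r12)// ler1n.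
have b1 : N1 <= (X ^+ dS) ^+ 16 * (r1 ^+ dS) ^+ 16.
  apply: (le_trans hN1); rewrite ![(_ ^+ dS) ^+ 16]exprAC -exprMn.
  rewrite lerXn2r ?nnegrE ?mulr_ge0 ?exprn_ge0//.
  by rewrite -exprMn; apply: le16.
have b2 : N2 <= (k1 ^+ dTh) ^+ 16.
  apply: (le_trans hN2); rewrite exprAC.
  rewrite lerXn2r ?nnegrE ?mulr_ge0 ?exprn_ge0//.
  by apply: le16 => //; rewrite ler_wpM2r// ler_weXn2l// ler1n.
(* The state net uses [dS] of the [dS.+1] powers of [X]; the remaining one absorbs the factor 2 of
   the two-sided tail. *)
have b0 : 2 <= X ^+ 16.
  by apply: le16 => //; apply: (le_trans X2); rewrite ler_peMl// exprn_ege1// ler1n.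
rewrite [X ^+ dS.+1]exprS [(X * _) ^+ 16]exprMn.
move: ((T%:R ^+ 2) ^+ 16) (X ^+ 16) ((X ^+ dS) ^+ 16) ((r1 ^+ dS) ^+ 16)
  ((k1 ^+ dTh) ^+ 16) T32 b0 b1 b2 => t x xd rd kd t1 x2 N1le N2le.
have -> : t * (x * xd) * rd * kd = t * (x * (xd * rd * kd)) by rewrite !mulrA.
rewrite -[leLHS]mul1r; apply: ler_pM => //; first by rewrite !mulr_ge0.
by apply: ler_pM => //; [rewrite mulr_ge0|apply: ler_pM].
Qed.

(** * Nets, constants and the event of small deviation *)

Section uniform_deviation.
Context (R : realType) (dS dA dTh : nat) (M : soc R dS dA) (pi : policy M).
Context (r L LC LTh RTh Lpi eps delta : R).
Context (Theta : set 'rV[R]_dTh) (f : 'rV[R]_dTh -> R -> R).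
Context (L_gt0 : 0 < L) (reg : soc_regular M r L) (LC_gt0 : 0 < LC).

Let T := horizon M.

Context (regf : risk_family_regular T Theta f LC LTh RTh).
Context (Lpi_gt0 : 0 < Lpi) (piL : policy_lipschitz pi Lpi).

Let D := LC * T.+1%:R.

Lemma risk_family_lipschitz_cost theta : Theta theta ->
  lipschitz_cost M (f theta) (f theta 0) D LC.
Proof.
move=> th; have [fL _ _] := regf; split=> [z /andP[z0 zT]|z z' zT zT'].
  apply: le_trans (fL _ _ _ th _ _) _; rewrite ?z0 ?zT ?lexx ?ler0n//.
  by rewrite subr0 ger0_norm// ler_wpM2l// ltW.
exact: fL.
Qed.

Let B := T%:R ^+ 2 * Num.max LC 2 * Num.max Lpi 2 * Num.max L 2 ^+ T.+1.

(** Bound on the state Lipschitz constants: 3 comes from [lipS_le], and 9 = 1 + 8 from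
    [LC + 2 * D * Lpi * T.+1] with [T.+1 <= 2 * T]. *)
Let A := 27 * B.

Let T_ge1 : (1 : R) <= T%:R.
Proof. by rewrite ler1n; exact: horizon_gt0. Qed.

Let D_ge0 : 0 <= D.
Proof. by rewrite mulr_ge0// ltW. Qed.

Let B_ge1 : 1 <= B.
Proof.
have m1 (z : R) : 1 <= Num.max z 2.
  by rewrite le_max; apply/orP; right; lra.
by rewrite !mulr_ege1 ?exprn_ege1.
Qed.

Let A_ge1 : 1 <= A.
Proof. by rewrite mulr_ege1 ?B_ge1// ler1n. Qed.

Lemma lipS_uniform_le j : (j <= T.+1)%N -> lipS L Lpi D LC j <= A.
Proof.
move=> jT; set L1 := Num.max L 2; set P1 := Num.max Lpi 2; set C1 := Num.max LC 2.
have LL1 : L <= L1 by rewrite le_max lexx.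
have LpiP1 : Lpi <= P1 by rewrite le_max lexx.
have CC1 : LC <= C1 by rewrite le_max lexx.
have L12 : 2 <= L1 by rewrite le_max lexx orbT.
have P12 : 2 <= P1 by rewrite le_max lexx orbT.
pose b := 9 * (T%:R ^+ 2 * C1 * P1).
have T1 := T_ge1; have LC0 := LC_gt0; have Lpi0 := Lpi_gt0.
have TS : (T.+1%:R : R) <= 2 * T%:R by rewrite -natr1; lra.
have TS0 : (0 : R) <= T.+1%:R by [].
have C10 : 0 <= C1 by lra.
have P10 : 0 <= P1 by lra.
have hb : LC + 2 * D * Lpi *+ j <= b.
  apply: le_trans (_ : C1 * (T%:R ^+ 2 * P1) + 2 * (C1 * (2 * T%:R)) * P1 * (2 * T%:R) <= _).
    rewrite -[_ *+ j]mulr_natr; apply: lerD.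
      apply: (le_trans CC1); apply: ler_peMr => //.
      by rewrite mulr_ege1 ?exprn_ege1//; lra.
    apply: ler_pM => //; first by rewrite !mulr_ge0// ltW.
      apply: ler_pM => //; [by rewrite mulr_ge0|exact: ltW|].
      by rewrite ler_wpM2l//; apply: ler_pM => //; exact: ltW.
    by apply: le_trans TS; rewrite ler_nat.
  by rewrite /b le_eqVlt; apply/orP; left; apply/eqP; ring.
have b0 : 0 <= b.
  apply: (le_trans _ hb); apply: addr_ge0; first exact: ltW.
  by apply: mulrn_wge0; rewrite !mulr_ge0// ltW.
apply: le_trans (lipS_le _ LL1 L12 _ _ _ hb) _; rewrite ?(ltW L_gt0) ?(ltW LC_gt0) ?(ltW Lpi_gt0)//.
have -> : A = 3 * L1 ^+ T.+1 * b by rewrite /A /B /b -/L1 -/P1 -/C1; ring.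
rewrite ler_wpM2r// ler_wpM2l//.
have : L1 ^+ j <= L1 ^+ T.+1 by rewrite ler_weXn2l//; lra.
by lra.
Qed.

Context (eps_gt0 : 0 < eps) (delta_itv : 0 < delta < 1).
Context (s0 : 'rV[R]_dS) (Ss0 : states M 0 s0).
Context (th0 : 'rV[R]_dTh) (Theta0 : Theta th0).

Let r_ge0 : 0 <= r.
Proof.
have [v /(_ _ Ss0)] := states_radius reg (leq0n T).
by apply: le_trans; exact: enorm_ge0.
Qed.

Let RTh_ge0 : 0 <= RTh.
Proof.
have [_ _ [v /(_ _ Theta0)]] := regf.
by apply: le_trans; exact: enorm_ge0.
Qed.

Lemma state_net : exists N : nat,
  N%:R <= (2 ^+ 13 * (T%:R ^+ 3 * Num.max LC 2 * Num.max Lpi 2 *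
    Num.max L 2 ^+ T.+1 * Num.max eps^-1 2 * Num.max r 2)) ^+ dS /\
  exists rep : 'I_N -> 'rV[R]_dS, (forall i, states M 0 (rep i)) /\
    forall s, states M 0 s -> exists i, A * enorm (s - rep i) <= eps / 8.
Proof.
(* Chosen so that [A * (r / K) <= eps / 8]. *)
pose K := (Num.truncn (8 * A * r / eps)).+1.
have A0 : 0 < A by apply: lt_le_trans A_ge1.
have K0 : (0 : R) < K%:R by rewrite ltr0n.
have v0 : 0 <= 8 * A * r / eps.
  by rewrite divr_ge0 ?(ltW eps_gt0)// mulr_ge0// mulr_ge0// ltW.
have /andP[K1 K2] := truncn_itv v0.
have [N [hN net]] := ball_cover dS (ltn0Sn _ : (0 < K)%N) r_ge0.
exists N; split.
  apply: le_trans hN _; rewrite lerXn2r ?nnegrE ?ler0n//.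
    by rewrite !mulr_ge0 ?exprn_ge0// le_max ler0n orbT.
  rewrite natrM /K -natr1.
  set a := Num.truncn _ in K1 *; set e1 := Num.max eps^-1 2; set r1 := Num.max r 2.
  have r12 : 2 <= r1 by rewrite le_max lexx orbT.
  have e12 : 2 <= e1 by rewrite le_max lexx orbT.
  have re : r * eps^-1 <= r1 * e1.
    by apply: ler_pM; rewrite ?invr_ge0 ?(ltW eps_gt0) ?le_max ?lexx.
  have re1 : 1 <= r1 * e1 by nra.
  have h1 : a%:R <= 216 * B * (r1 * e1).
    apply: (le_trans K1); rewrite /A.
    have -> : 8 * (27 * B) * r / eps = 216 * B * (r * eps^-1).
      by field; rewrite gt_eqF.
    exact: (ler_wpM2l (mulr_ge0 (ler0n _ _) (le_trans ler01 B_ge1)) re).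
  have h2 : 1 <= B * (r1 * e1) by rewrite mulr_ege1 ?B_ge1.
  (* [32 * (216 + 1) <= 2 ^+ 13], where 32 is from [ball_cover] and 216 = 8 * 27. *)
  apply: le_trans (_ : 2 ^+ 13 * (B * (r1 * e1)) <= _); first by lra.
  rewrite ler_wpM2l ?exprn_ge0//.
  have -> : T%:R ^+ 3 * Num.max LC 2 * Num.max Lpi 2 *
    Num.max L 2 ^+ T.+1 * e1 * r1 = T%:R * (B * (r1 * e1)) by rewrite /B; ring.
  by rewrite ler_peMl//; lra.
have [rep [repS close]] := net _ (states_radius reg (leq0n T)) (ex_intro _ _ Ss0).
exists rep; split=> // s Ss; have [i hi] := close _ Ss; exists i.
apply: le_trans (ler_wpM2l (ltW A0) hi) _.
rewrite mulrA ler_pdivrMr// -ler_pdivrMl ?divr_gt0//.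
apply: le_trans (ltW K2); rewrite le_eqVlt; apply/orP; left; apply/eqP.
by field; rewrite gt_eqF.
Qed.

Lemma parameter_net : exists N : nat,
  N%:R <= (2 ^+ 9 * Num.max (LTh * RTh / eps) 2) ^+ dTh /\
  exists rep : 'I_N -> 'rV[R]_dTh, (forall i, Theta (rep i)) /\
    forall theta, Theta theta ->
      exists i, LTh * enorm (theta - rep i) <= eps / 8.
Proof.
have [_ _ radTh] := regf.
pose k := LTh * RTh / eps; pose K := (Num.truncn (8 * k)).+1.
have K0 : (0 : R) < K%:R by rewrite ltr0n.
have k12 : 2 <= Num.max k 2 by rewrite le_max lexx orbT.
have kk1 : k <= Num.max k 2 by rewrite le_max lexx.
have [N [hN net]] := ball_cover dTh (ltn0Sn _ : (0 < K)%N) RTh_ge0.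
exists N; split.
  apply: le_trans hN _; rewrite -/k lerXn2r ?nnegrE ?ler0n//.
    by rewrite mulr_ge0 ?exprn_ge0//; lra.
  rewrite natrM /K -natr1.
  (* The sign of [LTh] is not prescribed; for negative [k] the truncation is 0 and [K = 1]. *)
  have [k0|k0] := leP 0 (8 * k).
    by have /andP[K1 _] := truncn_itv k0; lra.
  have -> : Num.truncn (8 * k) = 0%N.
    by apply/eqP; rewrite -leqn0 leqNgt truncn_gt0 -ltNge; lra.
  by lra.
have [rep [repT close]] := net _ radTh (ex_intro _ _ Theta0).
exists rep; split=> // theta th; have [i hi] := close _ th; exists i.
have [L0|L0] := leP 0 LTh; last first.
  apply: le_trans (_ : 0 <= _); last by rewrite divr_ge0// ltW.
  by rewrite nmulr_rle0// enorm_ge0.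
have k0 : 0 <= 8 * k by rewrite !mulr_ge0 ?invr_ge0// ltW.
have /andP[_ K2] := truncn_itv k0.
apply: le_trans (ler_wpM2l L0 hi) _.
rewrite mulrA ler_pdivrMr// -ler_pdivrMl ?divr_gt0//.
apply: le_trans (ltW K2); rewrite le_eqVlt; apply/orP; left; apply/eqP.
by rewrite /k; field; rewrite gt_eqF.
Qed.

Context (n : nat).
Context (tail : forall N1 N2 : R, 0 <= N1 -> 0 <= N2 ->
  N1 <= (2 ^+ 13 * (T%:R ^+ 3 * Num.max LC 2 * Num.max Lpi 2 *
    Num.max L 2 ^+ T.+1 * Num.max eps^-1 2 * Num.max r 2)) ^+ dS ->
  N2 <= (2 ^+ 9 * Num.max (LTh * RTh / eps) 2) ^+ dTh ->
  2 * (N1 * N2) *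
    expR (- (n.+1%:R * (eps / 4) ^+ 2 / (8 * (2 * D) ^+ 2))) <= delta).
Context (d : measure_display) (Omega : measurableType d)
  (Pr : probability Omega R) (Y : forall t, nat -> Omega -> borel (noise M t)).
Context (iid : iid_noise_samples Pr n.+1 Y).

(** The event constrains only finitely many codes at net points, so no measurability of a supremum
    over [s] is involved. State net, parameter net and noise cells cost [eps / 8] each, for the true
    and for the empirical laws; the deviation at net points costs [eps / 4]. *)
Lemma uniform_deviation : exists E : set Omega,
  [/\ measurable E, ((1 - delta)%:E <= Pr E)%E &
    forall w, E w -> forall s, states M 0 s ->
      `|empirical_risk pi n.+1 (fun t i => Y t i w) Theta f s
         - risk pi Theta f s| <= eps].
Proof.
have [mY lawY indY] := iid.
have [NS [hNS [repS [SrepS closeS]]]] := state_net.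
have [NT [hNT [repT [TrepT closeT]]]] := parameter_net.
have A0 : 0 < A by apply: lt_le_trans A_ge1.
have T0 : (0 : R) < T%:R by apply: lt_le_trans T_ge1.
pose eta := eps / 8 / T%:R / A.
have eta0 : 0 < eta by rewrite !divr_gt0.
have Teta : T%:R * (A * eta) = eps / 8.
  by rewrite /eta; field; rewrite !gt_eqF.
have [Q codeH] := noise_partition reg (ltW L_gt0) r_ge0 eta0.
pose code t : borel (noise M t) -> Q := sval (cid (codeH t)).
have mcode t q : measurable (code t @^-1` [set q]).
  by rewrite /code; case: (cid _) => /= c [].
have codeP t : (t < T)%N -> forall xi xi' : noise M t,
  code t xi = code t xi' -> forall s a, states M t s -> controls M t a ->
  enorm (transition M t s a xi - transition M t s a xi') <= eta.
  by rewrite /code; case: (cid _) => /= c [].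
pose p (t : 'I_T) := cell_mass (noise_law M t) (code t).
have p0 t q : 0 <= p t q by exact: cell_mass_ge0.
have p1 t : \sum_q p t q = 1.
  by apply: cell_mass_sum1; [exact: probability_setT|exact: mcode].
pose X (t : 'I_T) (j : 'I_n.+1) := Y t j.
pose Z := sample_code X (fun t : 'I_T => code t).
pose h (ij : 'I_NS * 'I_NT) rho :=
  path_value pi (f (repT ij.2)) code rho T 0 (repS ij.1) 0.
pose bad (ij : 'I_NS * 'I_NT) (z : {ffun 'I_n.+1 -> {ffun 'I_T -> Q}}) :=
  eps / 4 <= `|sample_mean z (h ij) - prod_mean p (h ij)|.
have [mbad Prbad] : measurable [set w | [exists ij, bad ij (Z w)]] /\
    (Pr [set w | [exists ij, bad ij (Z w)]] <= delta%:E)%E.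
  have lawX (t : 'I_T) (j : 'I_n.+1) q :
      Pr (X t j @^-1` (code t @^-1` [set q])) = (p t q)%:E.
    rewrite lawY// /p /cell_mass fineK//.
    exact: fin_num_measure.
  have [mB PB] := @sample_code_pred R d Omega Pr T n _ _ X Q
    (fun t => code t) p (fun t j => mY t j (ltn_ord t) (ltn_ord j))
    (fun t => mcode t) lawX indY (fun z => [exists ij, bad ij z]).
  split=> //; apply: le_trans PB _; rewrite lee_fin.
  apply: le_trans (sum_exists_le _ _) _; first by move=> z; exact: sample_weight_ge0.
  apply: le_trans (_ : \sum_(ij : 'I_NS * 'I_NT) 2 *
    expR (- (n.+1%:R * (eps / 4) ^+ 2 / (8 * (2 * D) ^+ 2))) <= _).
    apply: ler_sum => ij _; apply: sample_tail => //.
    - by rewrite !mulr_gt0.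
    - by rewrite divr_gt0.
    have [gD gL] := risk_family_lipschitz_cost (TrepT ij.2).
    have hD rho : `|h ij rho - f (repT ij.2) 0| <= D.
      have [hb _] := tame_path_value reg piL (ltW L_gt0) (ltW Lpi_gt0) D_ge0
        (ltW LC_gt0) gD gL code rho (add0n T).
      by apply: hb => //; rewrite lexx.
    (* Path values and their mean both lie within [D] of [f (repT ij.2) 0], hence within [2 * D] of
       each other. *)
    move=> rho; apply: le_trans (ler_distD (f (repT ij.2) 0) _ _) _.
    rewrite [leRHS]mulr_natl mulr2n; apply: lerD => //.
    by rewrite distrC; apply: prod_mean_dist.
  rewrite sumr_const card_prod !card_ord -[leLHS]mulr_natl natrM.
  by rewrite mulrA [_ * 2]mulrC; exact: tail.
exists (~` [set w | [exists ij, bad ij (Z w)]]); split.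
- exact: measurableC.
- by rewrite probability_setC// EFinB leeB.
move=> w /= good s Ss.
rewrite /empirical_risk /risk !risk_of_value.
apply: inf_dist_le; first exact: ltW.
move=> theta th.
have [i hi] := closeS _ Ss; have [j hj] := closeT _ th.
have lipA k : (k <= T)%N -> lipS L Lpi D LC k <= A.
  by move=> kT; apply: lipS_uniform_le; exact: leqW.
have [gD gL] := risk_family_lipschitz_cost th.
have [gD' gL'] := risk_family_lipschitz_cost (TrepT j).
have x0 : 0 <= (0 : R) <= 0%:R by rewrite lexx.
have near_expansion (P : forall t, {measure set (borel (noise M t)) -> \bar R}) :
    (forall u, (u < T)%N -> P u setT = 1%E) ->
    `|value pi P (f theta) T 0 s 0 -
      prod_mean (fun t : 'I_T => cell_mass (P t) (code t)) (h (i, j))|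
    <= 3 * (eps / 8).
  move=> P1.
  have h1 : `|value pi P (f theta) T 0 s 0 - value pi P (f theta) T 0 (repS i) 0|
      <= eps / 8.
    have [_ hl] := tame_value reg piL (ltW L_gt0) (ltW Lpi_gt0) D_ge0
      (ltW LC_gt0) gD gL P1 (add0n T).
    apply: le_trans (hl _ _ _ _ Ss (SrepS i) x0 x0) _.
    rewrite subrr normr0 mulr0 addr0; apply: le_trans hi.
    by rewrite ler_wpM2r ?enorm_ge0//; exact: lipS_uniform_le.
  have h2 : `|value pi P (f theta) T 0 (repS i) 0 -
      value pi P (f (repT j)) T 0 (repS i) 0| <= eps / 8.
    apply: (value_dist_cost reg piL (ltW L_gt0) (ltW Lpi_gt0) P1 D_ge0
      (ltW LC_gt0) (risk_family_lipschitz_cost th)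
      (risk_family_lipschitz_cost (TrepT j))) => // z zT.
    have [_ fTh _] := regf.
    exact: le_trans (fTh _ _ _ th (TrepT j) zT) hj.
  have h3 : `|value pi P (f (repT j)) T 0 (repS i) 0 -
      prod_mean (fun t : 'I_T => cell_mass (P t) (code t)) (h (i, j))| <= eps / 8.
    rewrite -Teta.
    exact: (value_path_expansion reg piL (ltW L_gt0) (ltW Lpi_gt0) D_ge0
      (ltW LC_gt0) gD' gL' mcode codeP P1 lipA (ltW eta0) (add0n T) (SrepS i) x0).
  have := ler_distD (value pi P (f theta) T 0 (repS i) 0)
    (value pi P (f theta) T 0 s 0)
    (prod_mean (fun t : 'I_T => cell_mass (P t) (code t)) (h (i, j))).
  have := ler_distD (value pi P (f (repT j)) T 0 (repS i) 0)
    (value pi P (f theta) T 0 (repS i) 0)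
    (prod_mean (fun t : 'I_T => cell_mass (P t) (code t)) (h (i, j))).
  by lra.
have := near_expansion (fun t => noise_law M t) (fun u _ => probability_setT _).
have := near_expansion (fun t => empirical_law n.+1 (fun i => Y t i w))
  (fun u _ => empirical_law_setT n (fun t i => Y t i w) u).
rewrite -/p.
(* Cell masses of the empirical laws are the code frequencies of the sample. *)
have -> : prod_mean (fun t : 'I_T => cell_mass
    (empirical_law n.+1 (fun i => Y t i w) : {measure set _ -> \bar R}) (code t))
    (h (i, j)) = sample_mean (Z w) (h (i, j)).
  apply: eq_bigr => rho _; congr (_ * _); apply: eq_bigr => t _.
  rewrite (empirical_cell_mass n (fun t i => Y t i w) (code t)) /freq.
  by congr (_ * _); apply: eq_bigr => l _; rewrite !ffunE.
have : `|sample_mean (Z w) (h (i, j)) - prod_mean p (h (i, j))| < eps / 4.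
  rewrite ltNge; apply/negP => hb; apply: good.
  by apply/existsP; exists (i, j).
move=> h1 h2; rewrite distrC => h3.
have := ler_distD (sample_mean (Z w) (h (i, j)))
  (value pi (fun t => empirical_law n.+1 (fun i => Y t i w)) (f theta) T 0 s 0)
  (value pi (fun t => noise_law M t) (f theta) T 0 s 0).
have := ler_distD (prod_mean p (h (i, j))) (sample_mean (Z w) (h (i, j)))
  (value pi (fun t => noise_law M t) (f theta) T 0 s 0).
rewrite -/T; lra.
Qed.

End uniform_deviation.

Theorem theorem3p3 (R : realType) :
  exists C : R, 0 < C /\
  forall (dS dA dTh : nat) (M : soc R dS dA) (r L : R)
    (Theta : set 'rV[R]_dTh) (f : 'rV[R]_dTh -> R -> R) (LC LTh RTh : R)
    (pi : policy M) (Lpi eps delta : R),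
  0 < L -> soc_regular M r L ->
  0 < LC -> risk_family_regular (horizon M) Theta f LC LTh RTh ->
  0 < Lpi -> policy_lipschitz pi Lpi ->
  0 < eps -> 0 < delta < 1 ->
  let n :=
    sample_size C (horizon M) dS dTh LC Lpi L r LTh RTh eps delta in
  forall (d : measure_display) (Omega : measurableType d)
    (Pr : probability Omega R)
    (Y : forall t, nat -> Omega -> borel (noise M t)),
  iid_noise_samples Pr n Y ->
  exists E : set Omega,
    [/\ measurable E, ((1 - delta)%:E <= Pr E)%E &
        forall w, E w -> forall s, states M 0 s ->
          `|empirical_risk pi n (fun t i => Y t i w) Theta f s
             - risk pi Theta f s| <= eps].
Proof.
exists (2 ^+ 15); split; first exact: exprn_gt0.
move=> dS dA dTh M r L Theta f LC LTh RTh pi Lpi eps delta.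
move=> L0 reg LC0 regf Lpi0 piL eps0 delta01 n d Omega Pr Y iid.
have /andP[d0 d1] := delta01.
have trivial_event : (forall w s, states M 0 s ->
    `|empirical_risk pi n (fun t i => Y t i w) Theta f s
       - risk pi Theta f s| <= eps) -> exists E : set Omega,
    [/\ measurable E, ((1 - delta)%:E <= Pr E)%E &
        forall w, E w -> forall s, states M 0 s ->
          `|empirical_risk pi n (fun t i => Y t i w) Theta f s
             - risk pi Theta f s| <= eps].
  move=> h; exists setT; split=> //.
    by rewrite probability_setT lee_fin; lra.
  by move=> w _ s; exact: h.
(* The nets, and the signs of [r] and [RTh], need a point in [states M 0] and in [Theta]; with
   either set empty, every outcome satisfies the bound. *)
have [[s0 Ss0]|noS] := pselect (states M 0 !=set0); last first.
  by apply: trivial_event => w s Ss; exfalso; apply: noS; exists s.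
have [[th0 Th0]|noT] := pselect (Theta !=set0); last first.
  apply: trivial_event => w s Ss; rewrite /empirical_risk /risk !risk_of_value.
  by apply: inf_dist_le => [|th Th]; [exact: ltW|exfalso; apply: noT; exists th].
have T0 := horizon_gt0 M.
have max2_ge0 (z : R) : 0 <= Num.max z 2 by rewrite le_max ler0n orbT.
(* Positivity of [n] does not depend on the covering numbers, so they are instantiated with 0; it
   gives [n] the form [n'.+1] on which cyclic shifts are defined. *)
have n0 : (0 < n)%N.
  apply: proj1 (@sample_size_tail R (horizon M) dS dTh LC Lpi L r LTh RTh eps
    delta 0 0 T0 LC0 eps0 delta01 (lexx 0) (lexx 0) _ _);
    by rewrite !(exprn_ge0, mulr_ge0).
have tail (N1 N2 : R) hN1 hN2 h1 h2 := proj2 (@sample_size_tail R (horizon M) dS dTh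
  LC Lpi L r LTh RTh eps delta N1 N2 T0 LC0 eps0 delta01 hN1 hN2 h1 h2).
rewrite -/n in tail; clearbody n; case: n iid n0 tail {trivial_event} => // n' iid _ tail.
exact: (uniform_deviation L0 reg LC0 regf Lpi0 piL eps0 Ss0 Th0 tail iid).
Qed.
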